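(* (On duality of integer lengths and integer sines in sails.) Let $M$ be a mast segment of a Farey polyhedron having two neighbours, and let $\pi_1$ and $\pi_2$ be the planes (affine spans) of the principal faces, of the sail opposite to the mast of $M$, that contain the two neighbouring segments of $M$. Assume that $\dim\pi_1=\dim\pi_2=k$. Then the integer length $\mathrm{l}\ell(M)$ of $M$ multiplied by $k$ is the integer sine of the angle between $\pi_1$ and $\pi_2$: $$\mathrm{lsin}(\pi_1,\pi_2)=k\cdot \mathrm{l}\ell(M).$$
   Context: **Farey polyhedra.** In $\mathbb Z^n$ start with $V_1,\dots,V_n$ equal to the standard basis vectors, all indices active. A step at an active index $c$ replaces $V_c$ by $V_c'=\sum_{i\text{ active}}V_i$ and produces the Farey simplex with vertices the old $V_c$, the new $V_c'$ and the other active $V_i$. A continued fraction $(a_1,a_2,\dots)$ prescribes $a_1$ steps at index $1$, then $a_2$ steps at the next active index in cyclic order, and so on (elements may be zero); at prescribed moments some indices become inactive (the corresponding masts are dropped, the dimension drops). The Farey polyhedron is the union of these Farey simplices, with this subdivision and order. The $i$-th yard $T_i$ is the simplex on the active $V$'s after step $i$ (after dropping indices if a drop takes place there); $T_0$ is the deck, the last yard is the nest. The $j$-th mast is the broken line through the successive positions of $V_j$; its edges are mast edges. A mast segment is a maximal union of collinear consecutive mast edges, i.e. it corresponds to a positive element of the continued fraction. **Principal yards, division simplices, sails.** The deck and nest are principal; any other yard $T_i$ is principal if $\dim T_i<\dim T_{i-1}$ or if the index used in step $i+1$ differs from that used in step $i$. A division simplex is the convex hull of two consecutive principal yards (it is a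 simplex). The $j$-th sail (the sail opposite to the $j$-th mast) is the union of all faces of Farey simplices having all their vertices on masts other than the $j$-th. If $F_i$ is the intersection of a sail with the division simplex $D_i$, then $F_i$ is a principal face of the sail when $\dim F_i\ge \dim D_i-1$. **Neighbours.** Two mast segments on different masts are neighbours if the lines containing them intersect, in the sense of nose stretching: if one elongates a mast segment beyond its endpoint by one mast edge of that segment, one reaches the second vertex (endpoint of the first mast edge) of the next mast segment constructed by the algorithm, on another mast; these two segments are neighbours. Every mast segment has precisely two neighbours (the preceding and the following one), except for the first and last ones and places where the dimension drop destroys this incidence. **Integer invariants.** The integer length $\mathrm{l}\ell$ of a segment with integer endpoints is the number of integer points in its interior plus one. For a linearly independent family $X$ of integer vectors, $\mathrm{lV}(X)$ is the index of the sublattice generated by $X$ in the lattice of all integer vectors of its linear span ($\mathrm{lV}(\emptyset)=1$). For integer spaces $\pi_1,\pi_2$ meeting in an integer space, take lattice bases $P_1,P_2$ of their direction lattices such that $W=P_1\cap P_2$ is a lattice basis of the direction lattice of $\pi_1\cap\pi_2$; put $U=P_1\setminus W$, $V=P_2\setminus W$. Then $\mathrm{lsin}(\pi_1,\pi_2)=\dfrac{\mathrm{lV}(V,U,W)}{\mathrm{lV}(V)\,\mathrm{lV}(U)\,\mathrm{lV}(W)}$. *)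

(* Defs.v *)
From HB Require Import structures.
From mathcomp Require Import all_boot all_order all_algebra finmap.
From mathcomp Require Import boolp classical_sets functions cardinality.

Set Implicit Arguments.
Unset Strict Implicit.
Unset Printing Implicit Defensive.

Import Order.TTheory GRing.Theory Num.Theory.
Local Open Scope ring_scope.

(* Conventions.  The ambient lattice is Z^(n.+1), so that it has positive rank,
   and the indices 1, ..., n.+1 are the elements 0, ..., n of 'I_n.+1.
   Convex geometry takes place in R^(n.+1) over a real field R. *)

(** * Affine and convex geometry *)

Definition emb (R : realFieldType) (m : nat) (z : 'rV[int]_m) : 'rV[R]_m :=
  map_mx intr z.

Definition conv (R : realFieldType) (m : nat) (s : seq 'rV[R]_m) :
    set 'rV[R]_m :=
  [set x | exists w : 'I_(size s) -> R,
     [/\ forall i, 0 <= w i, \sum_i w i = 1 & x = \sum_i w i *: s`_i]]%classic.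

Record affine (R : realFieldType) (m : nat) := Affine {
  origin : 'rV[R]_m;
  direction : {vspace 'rV[R]_m} }.

Definition aff_set (R : realFieldType) (m : nat) (p : affine R m) :
    set 'rV[R]_m :=
  [set x | x - origin p \in direction p]%classic.

Definition aff_dim (R : realFieldType) (m : nat) (p : affine R m) : nat :=
  \dim (direction p).

(* [p] is the affine span of [X], i.e. the smallest affine subspace containing
   it; the empty set has none in this sense. *)
Definition is_aff_span (R : realFieldType) (m : nat) (p : affine R m)
    (X : set 'rV[R]_m) : Prop :=
  (X `<=` aff_set p)%classic /\
  forall q : affine R m, (X `<=` aff_set q)%classic ->
    (aff_set p `<=` aff_set q)%classic.

(** * Integer invariants *)

(* The number of integer points in the interior of [p, q], plus one.  Here and
   below [#|` fset_set A |] is the cardinality of [A], and 0 if [A] is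
   infinite. *)
Definition int_length (R : realFieldType) (m : nat) (p q : 'rV[int]_m) : nat :=
  #|` fset_set [set z : 'rV[int]_m | exists t : R,
        0 < t < 1 /\ emb R z = (1 - t) *: emb R p + t *: emb R q]%classic |.+1.

Definition zspan (m : nat) (X : seq 'rV[int]_m) : set 'rV[int]_m :=
  [set z | exists w : 'I_(size X) -> int, z = \sum_i w i *: X`_i]%classic.

Definition lattice_of (R : realFieldType) (m : nat) (U : {vspace 'rV[R]_m}) :
    set 'rV[int]_m :=
  [set z | emb R z \in U]%classic.

(* The number of cosets [z + L] with [z] in [L'], for [L] a subgroup of [L']. *)
Definition lattice_index (m : nat) (L' L : set 'rV[int]_m) : nat :=
  #|` fset_set [set C : set 'rV[int]_m | exists2 z, L' z &
        C = [set x | L (x - z)]]%classic |.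

Definition lV (R : realFieldType) (m : nat) (X : seq 'rV[int]_m) : nat :=
  lattice_index (lattice_of <<map (@emb R m) X>>%VS) (zspan X).

Definition integer_space (R : realFieldType) (m : nat) (p : affine R m) : Prop :=
  (exists z : 'rV[int]_m, aff_set p (emb R z)) /\
  (exists X : seq 'rV[int]_m, direction p = <<map (@emb R m) X>>%VS).

Definition lattice_basis (R : realFieldType) (m : nat) (X : seq 'rV[int]_m)
    (U : {vspace 'rV[R]_m}) : Prop :=
  free (map (@emb R m) X) /\ zspan X = lattice_of U.

(* [P1] and [P2] are bases as in the definition of the integer sine. *)
Definition adapted_bases (R : realFieldType) (m : nat) (p1 p2 : affine R m)
    (P1 P2 : seq 'rV[int]_m) : Prop :=
  [/\ integer_space p1, integer_space p2,
      lattice_basis P1 (direction p1), lattice_basis P2 (direction p2) &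
      exists q : affine R m,
        [/\ aff_set q = (aff_set p1 `&` aff_set p2)%classic,
            integer_space q &
            lattice_basis [seq x <- P1 | x \in P2] (direction q)]].

Definition lsin_value (R : realFieldType) (m : nat) (P1 P2 : seq 'rV[int]_m) :
    rat :=
  let W := [seq x <- P1 | x \in P2] in
  let U := [seq x <- P1 | x \notin W] in
  let V := [seq x <- P2 | x \notin W] in
  (lV R (V ++ U ++ W))%:R / ((lV R V)%:R * (lV R U)%:R * (lV R W)%:R).

(* [lsin(p1, p2) = s]: the integer sine is defined, and every admissible choice
   of bases computes the value [s]. *)
Definition is_lsin (R : realFieldType) (m : nat) (p1 p2 : affine R m) (s : rat) :
    Prop :=
  (exists P1 P2, adapted_bases p1 p2 P1 P2) /\
  (forall P1 P2, adapted_bases p1 p2 P1 P2 -> lsin_value R P1 P2 = s).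

(** * Farey polyhedra *)

(* [element P t] is the element a_(t+1) of the continued fraction, and
   [dropped P i] is the set of indices that become inactive at the yard T_i
   (only used for [i > 0]).  A finite continued fraction is represented by
   completing it with zeros, which prescribe no further steps. *)
Record farey (n : nat) := Farey {
  element : nat -> nat;
  dropped : nat -> {set 'I_n.+1} }.

Fixpoint active (n : nat) (P : farey n) (i : nat) : {set 'I_n.+1} :=
  if i is i'.+1 then (active P i' :\: dropped P i)%SET else finset.setT.

Definition steps_before (n : nat) (P : farey n) (t : nat) : nat :=
  \sum_(s < t) element P s.

(* The first of c+1, c+2, ..., in cyclic order, that belongs to [A]. *)
Definition next_active (n : nat) (A : {set 'I_n.+1}) (c : 'I_n.+1) : 'I_n.+1 :=
  head c [seq d <- traject (@ordS n.+1) (ordS c) n.+1 | d \in A].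

Fixpoint element_index (n : nat) (P : farey n) (t : nat) : 'I_n.+1 :=
  if t is t'.+1 then
    next_active (active P (steps_before P t)) (element_index P t')
  else ord0.

(* [step P i] is the index used in step i+1 (the step leading from T_i to
   T_(i+1)), or [None] if there are at most [i] steps.  The element prescribing
   this step is the first one whose steps go beyond the i-th. *)
Definition step (n : nat) (P : farey n) (i : nat) : option 'I_n.+1 :=
  match pselect (exists t, (i < steps_before P t.+1)%N) with
  | left h => Some (element_index P (ex_minn h))
  | right _ => None
  end.

(* [pos P i j] is the vector V_j after step [i]. *)
Fixpoint pos (n : nat) (P : farey n) (i : nat) : 'I_n.+1 -> 'rV[int]_n.+1 :=
  match i with
  | 0 => fun j => delta_mx 0 j
  | i'.+1 => fun j => if step P i' == Some j then
                        \sum_(l in active P i') pos P i' l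
                      else pos P i' j
  end.

Definition is_yard (n : nat) (P : farey n) (i : nat) : bool :=
  if i is i'.+1 then step P i' != None else true.

(* Steps are made at active indices, no step is degenerate (with a single
   active index V_c' would be V_c), and no yard is empty. *)
Definition well_formed (n : nat) (P : farey n) : Prop :=
  (forall i c, step P i = Some c -> c \in active P i /\ (1 < #|active P i|)%N) /\
  (forall i, is_yard P i -> active P i != finset.set0).

(* A vertex is a mast [v.1] together with a moment [v.2]: it stands for the
   position of V_(v.1) after step [v.2]. *)
Definition vertex_point (R : realFieldType) (n : nat) (P : farey n)
    (v : 'I_n.+1 * nat) : 'rV[R]_n.+1 :=
  emb R (pos P v.2 v.1).

Definition yard (n : nat) (P : farey n) (i : nat) : seq ('I_n.+1 * nat) :=
  [seq (j, i) | j <- enum (active P i)].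

(* The vertices of the Farey simplex produced by step i+1, made at index [c]. *)
Definition farey_simplex (n : nat) (P : farey n) (i : nat) (c : 'I_n.+1) :
    seq ('I_n.+1 * nat) :=
  (c, i.+1) :: yard P i.

Definition sail (R : realFieldType) (n : nat) (P : farey n) (j : 'I_n.+1) :
    set 'rV[R]_n.+1 :=
  [set x | exists i c (F : seq ('I_n.+1 * nat)),
     [/\ step P i = Some c, {subset F <= farey_simplex P i c},
         {in F, forall v, v.1 != j} & conv (map (vertex_point R P) F) x]]%classic.

(** * Principal yards and principal faces of sails *)

Definition yard_dim (n : nat) (P : farey n) (i : nat) : nat := #|active P i|.-1.

Definition principal (n : nat) (P : farey n) (i : nat) : bool :=
  is_yard P i &&
  [|| i == 0%N, step P i == None, (yard_dim P i < yard_dim P i.-1)%N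
    | step P i != step P i.-1].

Definition consecutive_principal (n : nat) (P : farey n) (i j : nat) : Prop :=
  [/\ (i < j)%N, principal P i, principal P j &
      forall k, (i < k < j)%N -> ~~ principal P k].

Definition division_simplex (R : realFieldType) (n : nat) (P : farey n)
    (i j : nat) : set 'rV[R]_n.+1 :=
  conv (map (vertex_point R P) (yard P i ++ yard P j)).

Definition principal_face (R : realFieldType) (n : nat) (P : farey n)
    (l : 'I_n.+1) (F : set 'rV[R]_n.+1) : Prop :=
  exists i j (pF pD : affine R n.+1),
    [/\ consecutive_principal P i j,
        F = (sail P l `&` division_simplex P i j)%classic,
        is_aff_span pF F, is_aff_span pD (division_simplex P i j) &
        (aff_dim pD <= (aff_dim pF).+1)%N].

(** * Mast segments and neighbours *)

(* The part of a mast from the beginning of its edge made in step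
   [seg_first].+1 to the end of its edge made in step [seg_last].+1. *)
Record segment (n : nat) := Segment {
  seg_mast : 'I_n.+1;
  seg_first : nat;
  seg_last : nat }.

Definition collinear_part (R : realFieldType) (n : nat) (P : farey n)
    (M : segment n) : Prop :=
  [/\ (seg_first M <= seg_last M)%N,
      step P (seg_first M) = Some (seg_mast M),
      step P (seg_last M) = Some (seg_mast M) &
      exists p d : 'rV[R]_n.+1, forall i, (seg_first M <= i <= (seg_last M).+1)%N ->
        exists t : R, emb R (pos P i (seg_mast M)) = p + t *: d].

Definition mast_segment (R : realFieldType) (n : nat) (P : farey n)
    (M : segment n) : Prop :=
  collinear_part R P M /\
  forall N : segment n, collinear_part R P N -> seg_mast N = seg_mast M ->
    (seg_first N <= seg_first M)%N -> (seg_last M <= seg_last N)%N -> N = M.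

Definition seg_start (n : nat) (P : farey n) (M : segment n) : 'rV[int]_n.+1 :=
  pos P (seg_first M) (seg_mast M).

Definition seg_end (n : nat) (P : farey n) (M : segment n) : 'rV[int]_n.+1 :=
  pos P (seg_last M).+1 (seg_mast M).

Definition seg_set (R : realFieldType) (n : nat) (P : farey n) (M : segment n) :
    set 'rV[R]_n.+1 :=
  conv [:: emb R (seg_start P M); emb R (seg_end P M)].

(* [N] is the next mast segment after [M], and elongating [M] by one of its
   edges (all of them are equal as vectors; the last one is used) leads to the
   second vertex of [N]. *)
Definition nose_stretching (R : realFieldType) (n : nat) (P : farey n)
    (M N : segment n) : Prop :=
  [/\ mast_segment R P M, mast_segment R P N, seg_mast M != seg_mast N,
      seg_first N = (seg_last M).+1 &
      seg_end P M + (seg_end P M - pos P (seg_last M) (seg_mast M))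
        = pos P (seg_first N).+1 (seg_mast N)].

Definition neighbours (R : realFieldType) (n : nat) (P : farey n)
    (M N : segment n) : Prop :=
  nose_stretching R P M N \/ nose_stretching R P N M.

(* Main.v *)
Require Import Defs.
From mathcomp Require Import all_boot all_order all_algebra finmap.
From mathcomp Require Import boolp classical_sets functions cardinality.
From mathcomp Require Import ring lra zify.


(** Why the sine is a multiple of the length.  Let the mast segment [M] lie on
    the mast [c] and be built by the steps from moment [f] to moment [g].  A
    step multiplies the matrix of positions by a unimodular matrix, so the
    positions [b_l] of the masts at moment [f] form a basis of the lattice, and
    everything is computed in the coordinates [y] of this basis.

    Because [M] is straight, all its steps are made at [c] and with the same
    set [A] of active indices ([collinear_run]); nose stretching at an end of
    [M] means exactly that no index is dropped there ([nose_active]).  Hence a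
    single set [A], with [a] elements, serves both neighbours of [M].

    A neighbour [N], on a mast [d], lies in one division simplex only, the one
    between the two yards where [N] begins and ends
    ([division_of_mast_segment]).  All vertices of this simplex lie on the
    hyperplane [sum_(l in A, l <> c) y_l - (a - 2) y_c = 1], except those on
    the mast [c], which lie below it; and the sail opposite to [c] meets the
    simplex only in this hyperplane ([sail_division]), because simplices
    produced earlier and later are separated by the yards between them.  So
    the plane of the principal face has the direction
    [sum_(l in A, l <> c) y_l = (a - 2) y_c], of dimension [a - 1]
    ([principal_face_direction]).  For the preceding neighbour these are
    coordinates at moment [f].  For the following one they are coordinates at
    moment [g], and since the mast [c] moves along [M] by [L = g - f] times
    the sum of the other [b_l], with [L] the integer length of [M]
    ([int_length_run]), the equation at moment [f] becomes
    [sum_(l in A, l <> c) y_l = (a - 2 + L (a - 1)) y_c] ([pencil_run]).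

    It remains to compute a sine inside the pencil of planes
    [sum_(l in A, l <> c) y_l = p y_c].  In adapted bases the three parts of a
    basis have volume 1, so that the sine of two spaces is the index of the sum
    of their lattices in the lattice of their sum ([lsin_valueE]).  For the
    parameters [p] and [q], the sum of the two lattices consists of the [y] for
    which [p - q] divides [sum_(l in A, l <> c) y_l - p y_c], a linear form
    that takes all integer values, so the index is [|p - q|]
    ([lsin_pencil]).  Here this is [L (a - 1)], and [a - 1] is the common
    dimension of the planes. *)


Set Implicit Arguments.
Unset Strict Implicit.
Unset Printing Implicit Defensive.

Import Order.TTheory GRing.Theory Num.Theory.
Local Open Scope ring_scope.

(** * Subgroups of the integer lattice and their indices *)

Section Lattices.
Variables (R : realFieldType) (m : nat).
Implicit Types (X Y : seq 'rV[int]_m) (z : 'rV[int]_m) (D : {vspace 'rV[R]_m}).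

Lemma embD z z' : emb R (z + z') = emb R z + emb R z'.
Proof. by rewrite /emb map_mxD. Qed.

Lemma embB z z' : emb R (z - z') = emb R z - emb R z'.
Proof. by rewrite /emb map_mxB. Qed.

Lemma emb0 : emb R (0 : 'rV[int]_m) = 0.
Proof. exact: map_mx0. Qed.

Lemma embZ (a : int) z : emb R (a *: z) = a%:~R *: emb R z.
Proof. by rewrite /emb map_mxZ. Qed.

Lemma emb_sum (I : Type) (s : seq I) (p : pred I) (F : I -> 'rV[int]_m) :
  emb R (\sum_(i <- s | p i) F i) = \sum_(i <- s | p i) emb R (F i).
Proof. exact: (big_morph (@emb R m) embD emb0). Qed.

Lemma emb_inj : injective (@emb R m).
Proof.
move=> z z' /rowP e; apply/rowP => i; have := e i; rewrite !mxE.
by move/intr_inj.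
Qed.

(** Induction principle used to show that all vectors of a span satisfy a
    system of linear equations. *)
Lemma span_ind (Q : 'rV[R]_m -> Prop) (X : seq 'rV[R]_m) :
    Q 0 -> (forall x y, Q x -> Q y -> Q (x + y)) ->
    (forall a x, Q x -> Q (a *: x)) -> {in X, forall x, Q x} ->
  {in <<X>>%VS, forall x, Q x}.
Proof.
move=> Q0 QD QZ QX x /(@coord_span _ _ _ (in_tuple X)) ->.
by elim/big_ind: _ => // i _; apply/QZ/QX; rewrite mem_nth.
Qed.

Lemma zspan_ind (Q : 'rV[int]_m -> Prop) X :
    Q 0 -> (forall x y, Q x -> Q y -> Q (x + y)) ->
    (forall a x, Q x -> Q (a *: x)) -> {in X, forall x, Q x} ->
  forall z, zspan X z -> Q z.
Proof.
move=> Q0 QD QZ QX z [w ->].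
by elim/big_ind: _ => // i _; apply/QZ/QX; rewrite mem_nth.
Qed.

Lemma zspan0 X : zspan X 0.
Proof. by exists (fun=> 0); rewrite big1 // => i _; rewrite scale0r. Qed.

Lemma zspanD X z z' : zspan X z -> zspan X z' -> zspan X (z + z').
Proof.
move=> [w ->] [w' ->]; exists (fun i => w i + w' i).
by rewrite -big_split; apply: eq_bigr => i _; rewrite scalerDl.
Qed.

Lemma zspanZ X a z : zspan X z -> zspan X (a *: z).
Proof.
move=> [w ->]; exists (fun i => a * w i).
by rewrite scaler_sumr; apply: eq_bigr => i _; rewrite scalerA.
Qed.

Lemma mem_zspan X z : z \in X -> zspan X z.
Proof.
move=> Xz; have lt := Xz; rewrite -index_mem in lt.
exists (fun i => (i == Ordinal lt)%:R).
rewrite (bigD1 (Ordinal lt)) //= eqxx scale1r nth_index // big1 ?addr0 //.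
by move=> i /negPf ->; rewrite scale0r.
Qed.

Lemma zspan_sub X Y z : {subset X <= Y} -> zspan X z -> zspan Y z.
Proof.
move=> sXY; apply: (@zspan_ind (zspan Y) X).
- exact: zspan0.
- exact: zspanD.
- by move=> a x; apply: zspanZ.
- by move=> x /sXY; apply: mem_zspan.
Qed.

Lemma zspan_sum X (I : Type) (s : seq I) (p : pred I) (F : I -> 'rV[int]_m) :
  (forall i, p i -> zspan X (F i)) -> zspan X (\sum_(i <- s | p i) F i).
Proof.
by move=> XF; elim/big_ind: _ => //; [apply: zspan0 | apply: zspanD].
Qed.

Lemma emb_zspan X z : zspan X z -> emb R z \in <<map (@emb R m) X>>%VS.
Proof.
apply: (@zspan_ind (fun z => emb R z \in _) X) => [|x y|a x|x Xx].
- by rewrite emb0 mem0v.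
- by rewrite embD; apply: memvD.
- by rewrite embZ; apply: memvZ.
- by rewrite memv_span ?map_f.
Qed.

Lemma zspan_cat X Y z :
  zspan (X ++ Y) z <-> exists2 x, zspan X x & exists2 y, zspan Y y & z = x + y.
Proof.
split.
  apply: (@zspan_ind (fun z => exists2 x, zspan X x &
    exists2 y, zspan Y y & z = x + y)).
  - by exists 0; [exact: zspan0|exists 0; [exact: zspan0|rewrite addr0]].
  - move=> _ _ [x Xx [y Yy ->]] [x' Xx' [y' Yy' ->]].
    exists (x + x'); [exact: zspanD|exists (y + y'); [exact: zspanD|]].
    by rewrite addrACA.
  - move=> a _ [x Xx [y Yy ->]]; exists (a *: x); [exact: zspanZ|].
    by exists (a *: y); [exact: zspanZ|rewrite scalerDr].
  - move=> x; rewrite mem_cat => /orP[Xx|Yx].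
      by exists x; [exact: mem_zspan|exists 0; [exact: zspan0|rewrite addr0]].
    by exists 0; [exact: zspan0|exists x; [exact: mem_zspan|rewrite add0r]].
move=> [x Xx [y Yy ->]]; apply: zspanD.
  by apply: zspan_sub Xx => v Xv; rewrite mem_cat Xv.
by apply: zspan_sub Yy => v Yv; rewrite mem_cat Yv orbT.
Qed.

(** A lattice basis spans the space only if the space is generated by integer
    vectors: the hypothesis on [Y] excludes irrational spaces. *)
Lemma lattice_basis_span X D Y :
  lattice_basis X D -> D = <<map (@emb R m) Y>>%VS ->
  <<map (@emb R m) X>>%VS = D.
Proof.
move=> [_ XD] DY; apply/eqP; rewrite eqEsubv; apply/andP; split.
  apply/span_subvP => _ /mapP[x /mem_zspan Xx ->].
  by move: Xx; rewrite XD.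
rewrite {1}DY; apply/span_subvP => _ /mapP[y Yy ->].
have: lattice_of D y by rewrite /lattice_of /= DY memv_span ?map_f.
by rewrite -XD => /emb_zspan.
Qed.

(** When [L] is cut out of [L'] by the divisibility of a linear form [psi] by
    [d], cosets are classified by the residue of [psi]; the vector [e], on which
    [psi] takes the value 1, provides a representative for every residue. *)
Lemma card_cosets (L' L : set 'rV[int]_m) (psi : 'rV[int]_m -> int)
    (d : nat) (e : 'rV[int]_m) : (0 < d)%N ->
    (forall z z', L' z -> L' z' -> L' (z - z')) ->
    (forall z z', psi (z - z') = psi z - psi z') ->
    (forall z, L z <-> L' z /\ (d%:Z %| psi z)%Z) ->
    (forall a, L' (a *: e) /\ psi (a *: e) = a) ->
  lattice_index L' L = d.
Proof.
move=> d0 L'B psiB LP eP; apply: card_fset_set.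
have L0 : L' 0 by rewrite -(scale0r e); case: (eP 0).
have LN z : L' z -> L' (- z) by move=> Lz; rewrite -sub0r; apply: L'B.
have LD z z' : L' z -> L' z' -> L' (z + z').
  by move=> Lz Lz'; rewrite -[z']opprK; apply: L'B => //; apply: LN.
pose C z := [set x | L (x - z)]%classic.
have CP z x : L' z -> C z x <-> L' x /\ (d%:Z %| psi x - psi z)%Z.
  move=> Lz; rewrite /C /= LP psiB; split=> -[Lx dx]; split=> //.
    by rewrite -(subrK z x); apply: LD.
  exact: L'B.
have Ceq z z' : L' z -> L' z' -> C z = C z' <-> (d%:Z %| psi z - psi z')%Z.
  move=> Lz Lz'; split=> [CC|dz].
    have : C z z by apply/CP => //; rewrite subrr dvdz0.
    by rewrite CC => /CP[].
  apply/seteqP; split=> x /CP[] // Lx dx; apply/CP => //; split=> //.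
    have -> : psi x - psi z' = (psi x - psi z) + (psi z - psi z') by ring.
    exact: rpredD.
  have -> : psi x - psi z = (psi x - psi z') - (psi z - psi z') by ring.
  exact: rpredB.
have -> : [set C0 | exists2 z, L' z & C0 = C z]%classic =
    ((fun r : nat => C (r%:Z *: e)) @` `I_d)%classic.
  apply/seteqP; split=> [_ [z Lz ->]|_ [r _ <-]]; last first.
    by exists (r%:Z *: e) => //; case: (eP r%:Z).
  have dn0 : d%:Z != 0 by rewrite eqz_nat -lt0n.
  exists `|(psi z %% d%:Z)%Z|%N.
    by rewrite /= -ltz_nat gez0_abs ?modz_ge0 // ltz_pmod.
  have [Le pe] := eP `|(psi z %% d%:Z)%Z|%:Z.
  apply/Ceq => //; rewrite pe gez0_abs ?modz_ge0 //.
  by rewrite -eqz_mod_dvd modz_mod.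
apply: (card_eq_trans (inj_card_eq _)) => //= r r'.
rewrite !inE /= => rd r'd CC; have [Lr pr] := eP r%:Z; have [Lr' pr'] := eP r'%:Z.
have /Ceq := CC; rewrite pr pr' => /(_ Lr Lr').
by rewrite -eqz_mod_dvd !modz_nat !modn_small // => /eqP[].
Qed.

Lemma lattice_index_refl X : lattice_index (zspan X) (zspan X) = 1%N.
Proof.
rewrite /lattice_index; set S := (X in fset_set X).
suff -> : S = [set zspan X]%classic by rewrite fset_set1 cardfs1.
have shift z : zspan X z -> [set x | zspan X (x - z)]%classic = zspan X.
  move=> Xz; apply/seteqP; split=> x /= Xx; last first.
    by rewrite -scaleN1r; apply: zspanD => //; apply: zspanZ.
  by rewrite -(subrK z x); apply: zspanD.
apply/seteqP; split=> [_ [z Xz ->]|_ ->] /=; first by rewrite shift.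
by exists 0; [exact: zspan0|rewrite shift //; exact: zspan0].
Qed.

(** Part of a lattice basis is a lattice basis of its span: an integer vector
    of this span has integer coordinates in the whole basis, and by freeness
    those outside the part vanish. *)
Lemma lV_part X D (p : pred 'rV[int]_m) :
  lattice_basis X D -> lV R [seq x <- X | p x] = 1%N.
Proof.
move=> [fX XD]; set Y := [seq x <- X | p x].
pose Z := [seq x <- X | predC p x].
have pX : perm_eq (Y ++ Z) X by rewrite perm_filterC.
suff latY : lattice_of <<map (@emb R m) Y>>%VS = zspan Y.
  by rewrite /lV latY lattice_index_refl.
have : free (map (@emb R m) (Y ++ Z)) by rewrite (perm_free (perm_map _ pX)).
rewrite map_cat cat_free => /and3P[_ _ /directv_addP YZ].
apply/seteqP; split=> z; last exact: emb_zspan.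
rewrite /lattice_of /= => Yz.
have /zspan_cat [y y_Y [z' z_Z zE]] : zspan (Y ++ Z) z.
  apply: (@zspan_sub X); first by move=> v; rewrite (perm_mem pX).
  rewrite XD; rewrite /lattice_of /=; move: Yz.
  apply/subvP/span_subvP => _ /mapP[v Yv ->].
  have : lattice_of D v by rewrite -XD; apply/mem_zspan/(mem_subseq (filter_subseq p X)).
  by [].
suff z0 : emb R z' = 0.
  by move: z0 zE; rewrite -emb0 => /emb_inj -> ->; rewrite addr0.
apply/eqP; rewrite -memv0 -YZ memv_cap (emb_zspan z_Z) andbT.
have -> : z' = z - y by rewrite zE addrC addKr.
by rewrite embB rpredB // emb_zspan.
Qed.

(** The denominator of the sine is 1 by [lV_part], and the vectors in the
    numerator are those of [P1] and [P2] together, so the value depends only on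
    the two spaces.  This is what makes the sine independent of the bases. *)
Lemma lsin_valueE D1 D2 X1 X2 P1 P2 :
    D1 = <<map (@emb R m) X1>>%VS -> D2 = <<map (@emb R m) X2>>%VS ->
    lattice_basis P1 D1 -> lattice_basis P2 D2 ->
  lsin_value R P1 P2 = (lattice_index (lattice_of (D1 + D2)%VS)
    [set z | exists2 x, lattice_of D1 x & exists2 y, lattice_of D2 y & z = x + y]%classic)%:R.
Proof.
move=> DX1 DX2 lP1 lP2.
have sP1 := lattice_basis_span lP1 DX1; have sP2 := lattice_basis_span lP2 DX2.
rewrite /lsin_value; set W := [seq x <- P1 | x \in P2].
rewrite (lV_part _ lP1) (lV_part _ lP2) (lV_part _ lP1) !mulr1.
set U := [seq x <- P1 | _]; set V := [seq x <- P2 | _].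
have mem_all : V ++ U ++ W =i P1 ++ P2.
  move=> x; rewrite !mem_cat !mem_filter.
  by case: (x \in P1); case: (x \in P2).
rewrite /lV; congr (lattice_index (lattice_of _) _)%:R.
  rewrite -sP1 -sP2 -span_cat -map_cat; apply: eq_span => x.
  by apply/mapP/mapP => -[y yP ->]; exists y => //; rewrite ?mem_all // -mem_all.
case: lP1 lP2 => _ <- [_ <-]; apply/seteqP.
have zE : zspan (V ++ U ++ W) = zspan (P1 ++ P2).
  by apply/seteqP; split=> z; apply: zspan_sub => v; rewrite mem_all.
by rewrite zE; split=> z; rewrite /= zspan_cat.
Qed.

End Lattices.

(** * A pencil of planes in coordinates of a unimodular basis *)

Section UnimodularBasis.
Variables (R : realFieldType) (m : nat) (B : 'M[int]_m).
Hypothesis unitB : B \in unitmx.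
Implicit Types (x : 'rV[R]_m) (z : 'rV[int]_m).

Definition crd x : 'rV[R]_m := x *m map_mx intr (invmx B).

Lemma crdD x y l : crd (x + y) 0 l = crd x 0 l + crd y 0 l.
Proof. by rewrite /crd mulmxDl mxE. Qed.

Lemma crdZ a x l : crd (a *: x) 0 l = a * crd x 0 l.
Proof. by rewrite /crd -scalemxAl mxE. Qed.

Lemma crd0 l : crd 0 0 l = 0.
Proof. by rewrite /crd mul0mx mxE. Qed.

Lemma crdB x y l : crd (x - y) 0 l = crd x 0 l - crd y 0 l.
Proof. by rewrite -scaleN1r crdD crdZ mulN1r. Qed.

Lemma crd_emb z l : crd (emb R z) 0 l = ((z *m invmx B) 0 l)%:~R.
Proof. by rewrite /crd /emb -map_mxM mxE. Qed.

Lemma crd_basis l j : crd (emb R (row l B)) 0 j = (l == j)%:R.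
Proof. by rewrite crd_emb -row_mul mulmxV // !mxE; case: eqP. Qed.

Lemma crd_expand x : x = \sum_l crd x 0 l *: emb R (row l B).
Proof.
have {1}-> : x = crd x *m map_mx intr B.
  by rewrite /crd -mulmxA -map_mxM mulVmx // map_mx1 mulmx1.
by rewrite mulmx_sum_row; apply: eq_bigr => l _; rewrite /emb map_row.
Qed.

Lemma functional_exists (f : 'I_m -> R) :
  exists u : 'cV[R]_m, forall l, (emb R (row l B) *m u) 0 0 = f l.
Proof.
exists (map_mx intr (invmx B) *m \col_l f l) => l.
rewrite mulmxA -/(crd _) mxE (bigD1 l) //= crd_basis eqxx mxE mul1r.
by rewrite big1 ?addr0 // => j /negPf jl; rewrite crd_basis eq_sym jl mul0r.
Qed.

(** Basis vectors sheared along a fixed one, [b_l0]: a lattice basis of the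
    space where [y_l0] is an integer combination of the coordinates [y_l] for
    [l] in [s] and the remaining coordinates vanish. *)
Definition frame (l0 : 'I_m) (r : 'I_m -> int) (s : seq 'I_m) :=
  [seq row l B + r l *: row l0 B | l <- s].

Section Frame.
Variables (l0 : 'I_m) (r : 'I_m -> int) (s : seq 'I_m).
Hypotheses (us : uniq s) (l0s : l0 \notin s).

Lemma crd_frame l j : crd (emb R (row l B + r l *: row l0 B)) 0 j =
  (l == j)%:R + (r l)%:~R * (l0 == j)%:R.
Proof. by rewrite embD embZ crdD crdZ !crd_basis. Qed.

Lemma frame_expand x :
    (forall l, l \notin s -> l != l0 -> crd x 0 l = 0) ->
    crd x 0 l0 = \sum_(l <- s) (r l)%:~R * crd x 0 l ->
  x = \sum_(l <- s) crd x 0 l *: emb R (row l B + r l *: row l0 B).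
Proof.
move=> x_s x_l0; rewrite {1}[x]crd_expand (bigD1 l0) //= x_l0.
rewrite (bigID (mem s) (fun i => i != l0)) /= [X in _ + (_ + X)]big1 ?addr0; last first.
  by move=> i /andP[il0 i_s]; rewrite x_s // scale0r.
rewrite [X in _ + X](eq_bigl (mem s)); last first.
  by move=> i; rewrite andb_idl // => i_s; apply: contraNneq l0s => <-.
rewrite -[X in _ + X](big_uniq _ us) scaler_suml -big_split /=; apply: eq_bigr => i _.
by rewrite embD embZ scalerDr scalerA [_ + crd _ _ _ *: _]addrC [_ * crd _ _ _]mulrC.
Qed.

Lemma frame_spanP x :
  x \in <<map (@emb R m) (frame l0 r s)>>%VS <->
  (forall l, l \notin s -> l != l0 -> crd x 0 l = 0) /\
  crd x 0 l0 = \sum_(l <- s) (r l)%:~R * crd x 0 l.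
Proof.
split=> [|[x_s x_l0]]; last first.
  rewrite (frame_expand x_s x_l0) big_seq; apply: memv_suml => l ls.
  by rewrite memvZ // memv_span // -map_comp; apply/mapP; exists l.
move: x; apply: (@span_ind R m (fun x =>
  (forall l, l \notin s -> l != l0 -> crd x 0 l = 0) /\
  crd x 0 l0 = \sum_(l <- s) (r l)%:~R * crd x 0 l)).
- split=> [l _ _|]; first exact: crd0.
  by rewrite crd0 big1 // => l _; rewrite crd0 mulr0.
- move=> x y [xs xl] [ys yl]; split=> [l ls ll|].
    by rewrite crdD xs // ys // addr0.
  rewrite crdD xl yl -big_split; apply: eq_bigr => l _.
  by rewrite crdD mulrDr.
- move=> a x [xs xl]; split=> [l ls ll|]; first by rewrite crdZ xs // mulr0.
  by rewrite crdZ xl mulr_sumr; apply: eq_bigr => l _; rewrite crdZ mulrCA.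
- move=> v; rewrite -map_comp => /mapP[i i_s ->] /=; split=> [l ls ll|].
    rewrite crd_frame (eq_sym l0) (negPf ll) mulr0 addr0.
    by case: (eqVneq i l) ls => // <-; rewrite i_s.
  rewrite crd_frame eqxx mulr1 (bigD1_seq i) //= crd_frame eqxx.
  have -> : (i == l0) = false by apply: contraNF l0s => /eqP <-.
  have -> : (l0 == i) = false by apply: contraNF l0s => /eqP ->.
  rewrite mulr0 addr0 mulr1 add0r big_seq_cond big1 ?addr0 //.
  move=> l /andP[ls li]; rewrite crd_frame eq_sym (negPf li).
  have -> : (l0 == l) = false by apply: contraNF l0s => /eqP ->.
  by rewrite mulr0 addr0 mulr0.
Qed.

End Frame.

Lemma frame_lattice_basis (l0 : 'I_m) r (s : seq 'I_m) : uniq s -> l0 \notin s ->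
  lattice_basis (frame l0 r s) <<map (@emb R m) (frame l0 r s)>>%VS.
Proof.
move=> us l0s; split.
  elim: s us l0s => [|i s' IH] /=; first by rewrite nil_free.
  move=> /andP[is' us']; rewrite inE negb_or => /andP[l0i l0s'].
  rewrite free_cons IH // andbT.
  apply/negP => /(frame_spanP r us' l0s' _)[/(_ i is')].
  rewrite eq_sym l0i crd_frame eqxx (negPf l0i) mulr0 addr0 => /(_ isT) /eqP.
  by rewrite oner_eq0.
  apply/seteqP; split=> z; first exact: emb_zspan.
  rewrite /lattice_of /= => zU; have [zs zl0] := (frame_spanP r us l0s _).1 zU.
  have -> : z = \sum_(l <- s) (z *m invmx B) 0 l *: (row l B + r l *: row l0 B).
    apply: (@emb_inj R); rewrite {1}(frame_expand us l0s zs zl0) emb_sum.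
    by apply: eq_bigr => l _; rewrite embZ crd_emb.
  rewrite big_seq; apply: zspan_sum => l ls; apply: zspanZ; apply: mem_zspan.
  exact: map_f.
Qed.

Section Pencil.
Variables (l0 c : 'I_m) (s : seq 'I_m).
Hypotheses (us : uniq s) (l0s : l0 \notin s) (cs : c \in s).

(** With these coefficients the equation of a frame reads
    [y_l0 + sum_(l <> c) y_l = p y_c]; as [l0] is one of the indices other than
    [c], this is the equation of the pencil solved for [y_l0]. *)
Definition slope (p : int) : 'I_m -> int := fun l => if l == c then p else -1.

Definition pencil (p : int) : {vspace 'rV[R]_m} :=
  <<map (@emb R m) (frame l0 (slope p) s)>>%VS.

Lemma pencilP p x : x \in pencil p <->
  (forall l, l \notin s -> l != l0 -> crd x 0 l = 0) /\
  crd x 0 l0 = p%:~R * crd x 0 c - \sum_(l <- s | l != c) crd x 0 l.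
Proof.
rewrite /pencil frame_spanP // (bigD1_seq c) //= /slope eqxx.
suff -> : \sum_(l <- s | l != c) (if l == c then p else -1)%:~R * crd x 0 l =
  - \sum_(l <- s | l != c) crd x 0 l by [].
rewrite -sumrN; apply: eq_bigr => l /negPf ->.
by rewrite mulrN1z mulN1r.
Qed.

Lemma c_neq_l0 : c != l0.
Proof. by apply: contraNneq l0s => <-. Qed.

(** Two planes of the pencil are hyperplanes of the space spanned by all [b_l]:
    a multiple of the generator of the second plane with [y_c = 1] brings any
    vector into the first. *)
Lemma pencil_add p q x : p != q ->
  x \in (pencil p + pencil q)%VS <->
  (forall l, l \notin s -> l != l0 -> crd x 0 l = 0).
Proof.
move=> pq; split=> [/memv_addP[y /pencilP[ys _] [y' /pencilP[ys' _] ->]] l ls ll|xs].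
  by rewrite crdD ys // ys' // addr0.
pose t := (crd x 0 l0 - p%:~R * crd x 0 c + \sum_(l <- s | l != c) crd x 0 l)
  / (q - p)%:~R.
pose x' := t *: emb R (row c B + slope q c *: row l0 B).
have x'q : x' \in pencil q.
  by rewrite memvZ // memv_span // -map_comp; apply/mapP; exists c.
rewrite -(subrK x' x); apply: memv_add => //; apply/pencilP.
have [x's x'l0] := (pencilP _ _).1 x'q.
split=> [l ls ll|]; first by rewrite crdB xs // x's // subr0.
have x'c : crd x' 0 c = t.
  by rewrite crdZ crd_frame eqxx eq_sym (negPf c_neq_l0) mulr0 addr0 mulr1.
rewrite crdB x'l0 crdB x'c (eq_bigr _ (fun l _ => crdB x x' l)) sumrB.
have tE : t * (q%:~R - p%:~R) = crd x 0 l0 - p%:~R * crd x 0 c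
    + \sum_(l <- s | l != c) crd x 0 l.
  by rewrite /t rmorphB /= divfK // subr_eq0 eqr_int eq_sym.
have -> : crd x 0 l0 = t * (q%:~R - p%:~R) + p%:~R * crd x 0 c
    - \sum_(l <- s | l != c) crd x 0 l by rewrite tE; ring.
by ring.
Qed.

Lemma pencil_cap p q : p != q ->
  (pencil p :&: pencil q)%VS =
  <<map (@emb R m) (frame l0 (fun=> -1) [seq l <- s | l != c])>>%VS.
Proof.
move=> pq; apply/vspaceP => x.
have us' : uniq [seq l <- s | l != c] by rewrite filter_uniq.
have l0s' : l0 \notin [seq l <- s | l != c].
  by rewrite mem_filter (negPf l0s) andbF.
have sumN : \sum_(l <- [seq l <- s | l != c]) (-1)%:~R * crd x 0 l =
    - \sum_(l <- s | l != c) crd x 0 l.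
  by rewrite big_filter -sumrN; apply: eq_bigr => l _; rewrite mulrN1z mulN1r.
rewrite memv_cap; apply/andP/idP.
  move=> [/pencilP[xs xp] /pencilP[_]]; rewrite xp => /addIr /eqP.
  rewrite -subr_eq0 -mulrBl mulf_eq0 subr_eq0 eqr_int (negPf pq) /= => /eqP xc.
  apply/frame_spanP => //; split=> [l|].
    rewrite mem_filter negb_and negbK => /orP[/eqP -> //|]; exact: xs.
  by rewrite xp xc mulr0 add0r sumN.
move=> /(frame_spanP _ us' l0s' _)[xs xl0].
have xc : crd x 0 c = 0.
  by apply: xs; rewrite ?c_neq_l0 // mem_filter eqxx.
by split; apply/pencilP; split=> [l ls ll|]; rewrite ?xl0 ?xc ?sumN ?mulr0 ?add0r //;
  apply: xs => //; rewrite mem_filter (negPf ls) andbF.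
Qed.

(** The frames of two planes differ only in their vector with index [c], so
    they are adapted to each other. *)
Lemma frame_slope_filter p q : p != q ->
  [seq x <- frame l0 (slope p) s | x \in frame l0 (slope q) s] =
  frame l0 (fun=> -1) [seq l <- s | l != c].
Proof.
move=> pq; rewrite /frame filter_map.
have <- : [seq l <- s | l != c] = [seq x <- s | preim
    (fun l : 'I_m => row l B + slope p l *: row l0 B)
    [in [seq row l B + slope q l *: row l0 B | l <- s]] x].
  apply: eq_in_filter => l ls /=.
  have [->|lc] := eqVneq l c; last first.
    apply/esym/mapP; exists l => //.
    by rewrite /slope (negPf lc).
  apply/esym/negP => c_in.
  have : emb R (row c B + slope p c *: row l0 B) \in pencil q.
    by rewrite memv_span // map_f.
  case/pencilP => _; rewrite !crd_frame !eqxx (eq_sym l0) (negPf c_neq_l0).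
  rewrite big_seq_cond big1 ?subr0; last first.
    move=> i /andP[i_s ic]; rewrite crd_frame (eq_sym c) (negPf ic).
    have -> : (l0 == i) = false by apply: contraNF l0s => /eqP ->.
    by rewrite mulr0 addr0.
  rewrite mulr0 addr0 !mulr1 add0r => /eqP.
  by rewrite /slope eqxx eqr_int (negPf pq).
apply/eq_in_map => l; rewrite mem_filter => /andP[/= + _].
by rewrite /slope => /negPf ->.
Qed.

Lemma aff_setE (pi : affine R m) a x :
  aff_set pi a -> aff_set pi x <-> x - a \in direction pi.
Proof.
rewrite /aff_set /= => api.
have -> : x - a = (x - origin pi) - (a - origin pi) by rewrite opprB addrA subrK.
split=> [xpi|xa]; first exact: memvB.
by rewrite -(subrK (a - origin pi) (x - origin pi)) memvD.
Qed.

(** With [psi = 0] the equation of the first plane, the equation of the second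
    is [psi = (q - p) y_c].  So the sum of the two lattices is the set where
    [q - p] divides [psi], whose index is [|p - q|]. *)
Lemma lsin_pencil p q (pi1 pi2 : affine R m) : p != q ->
    direction pi1 = pencil p -> direction pi2 = pencil q ->
    aff_set pi1 (emb R (row l0 B)) -> aff_set pi2 (emb R (row l0 B)) ->
  is_lsin pi1 pi2 `|p - q|%N%:R.
Proof.
move=> pq d1 d2 o1 o2.
have basis_p t : lattice_basis (frame l0 (slope t) s) (pencil t).
  exact: frame_lattice_basis.
split=> [|P1 P2 [_ _ lP1 lP2 _]].
  exists (frame l0 (slope p) s), (frame l0 (slope q) s); split.
  - by split; [exists (row l0 B)|exists (frame l0 (slope p) s)].
  - by split; [exists (row l0 B)|exists (frame l0 (slope q) s)].
  - by rewrite d1.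
  - by rewrite d2.
  exists (Affine (emb R (row l0 B)) (direction pi1 :&: direction pi2)%VS); split.
  - apply/seteqP; split=> x; rewrite /aff_set /= memv_cap.
      by move=> /andP[x1 x2]; split; [apply/(aff_setE _ o1)|apply/(aff_setE _ o2)].
    by move=> [/(aff_setE _ o1) -> /(aff_setE _ o2) ->].
  - split; first by exists (row l0 B); rewrite /aff_set /= subrr mem0v.
    by exists (frame l0 (fun=> -1) [seq l <- s | l != c]); rewrite /= d1 d2 pencil_cap.
  - rewrite /= d1 d2 frame_slope_filter // pencil_cap //.
    by apply: frame_lattice_basis; rewrite ?filter_uniq // mem_filter (negPf l0s) andbF.
rewrite d1 in lP1; rewrite d2 in lP2.
rewrite (lsin_valueE (erefl (pencil p)) (erefl (pencil q)) lP1 lP2); congr _%:R.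
pose y z := z *m invmx B : 'rV[int]_m.
have y0 l : y 0 0 l = 0 by rewrite /y mul0mx mxE.
pose psi z := y z 0 l0 - p * y z 0 c + \sum_(l <- s | l != c) y z 0 l.
have yB z z' l : y (z - z') 0 l = y z 0 l - y z' 0 l.
  by rewrite /y mulmxBl !mxE.
have psiB z z' : psi (z - z') = psi z - psi z'.
  by rewrite /psi !yB (eq_bigr _ (fun l _ => yB z z' l)) sumrB; ring.
have yrow a l j : y (a *: row l B) 0 j = a * (l == j)%:R.
  by rewrite /y -scalemxAl -row_mul mulmxV // !mxE.
have psi0 : psi 0 = 0.
  by rewrite /psi !y0 mulr0 subrr add0r big1 // => l _; rewrite y0.
have latP z : lattice_of (pencil p + pencil q)%VS z <->
    forall l, l \notin s -> l != l0 -> y z 0 l = 0.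
  rewrite /lattice_of /= pencil_add //; split=> zs l ls ll; have := zs l ls ll.
    by rewrite crd_emb => /eqP; rewrite intr_eq0 => /eqP.
  by rewrite crd_emb -/(y z) => ->.
have latpP t z : lattice_of (pencil t) z <->
    (forall l, l \notin s -> l != l0 -> y z 0 l = 0) /\ psi z = (t - p) * y z 0 c.
  have -> : lattice_of (pencil t) z <-> (forall l, l \notin s -> l != l0 ->
      y z 0 l = 0) /\ y z 0 l0 = t * y z 0 c - \sum_(l <- s | l != c) y z 0 l.
    rewrite /lattice_of /= pencilP !crd_emb (eq_bigr _ (fun l _ => crd_emb z l)).
    rewrite -[X in _ = _ - X]rmorph_sum -rmorphM -rmorphB /=.
    split=> -[zs zl0]; split=> [l ls ll|].
    - by have /eqP := zs l ls ll; rewrite crd_emb intr_eq0 => /eqP.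
    - exact: intr_inj zl0.
    - by rewrite crd_emb -/(y z) zs.
    - by rewrite -/(y z) zl0.
  rewrite /psi; split=> -[zs zl0]; split=> //; first by rewrite zl0; ring.
  apply/eqP; rewrite -subr_eq0; apply/eqP.
  transitivity (y z 0 l0 - p * y z 0 c + \sum_(l <- s | l != c) y z 0 l
    - (t - p) * y z 0 c); [by ring|by rewrite zl0 subrr].
apply: (@card_cosets m _ _ psi _ (row l0 B)).
- by rewrite absz_gt0 subr_eq0.
- move=> z z' /latP zs /latP zs'; apply/latP => l ls ll.
  by rewrite yB zs // zs' // subrr.
- exact: psiB.
- move=> z; rewrite /= latP; split.
    move=> [x /latpP[xs xp] [x' /latpP[x's x'q] ->]].
    have -> : x + x' = x - (0 - x') by rewrite sub0r opprK.
    split=> [l ls ll|]; first by rewrite !yB xs // x's // y0 !subrr.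
    rewrite !psiB psi0 xp x'q subrr mul0r !sub0r opprK dvdzE abszM distnC dvdn_mulr //.
  move=> [zs /dvdzP[a aE]].
  (* The generator with [y_c = 1], scaled so that [(q - p) y_c] is [psi z]. *)
  pose x' := (a * Num.sg (q - p)) *: (row c B + slope q c *: row l0 B).
  have x'q : lattice_of (pencil q) x'.
    rewrite /lattice_of /= embZ memvZ // memv_span //.
    by apply: map_f; apply/mapP; exists c.
  have yx' : y x' 0 c = a * Num.sg (q - p).
    rewrite /x' scalerDr scalerA -[X in _ + X]opprK -scaleNr yB !yrow eqxx.
    by rewrite eq_sym (negPf c_neq_l0) mulr0 subr0 mulr1.
  exists (z - x'); last by exists x'; rewrite ?subrK.
  have /latpP [x's x'E] := x'q.
  apply/latpP; split=> [l ls ll|]; first by rewrite yB zs // x's // subrr.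
  rewrite subrr mul0r psiB aE x'E yx' mulrCA [_ * Num.sg _]mulrC -normrEsg distrC -abszE subrr //.
- move=> a; split.
    by apply/latP => l ls ll; rewrite yrow eq_sym (negPf ll) mulr0.
  rewrite /psi !yrow eqxx eq_sym (negPf c_neq_l0) big_seq_cond big1.
    by rewrite addr0 !mulr0 subr0 mulr1.
  move=> i /andP[i_s ic]; rewrite yrow.
  have -> : (l0 == i) = false by apply: contraNF l0s => /eqP ->.
  by rewrite mulr0.
Qed.

Lemma dim_pencil p : \dim (pencil p) = size s.
Proof.
have [free_frame _] : lattice_basis (frame l0 (slope p) s) (pencil p).
  exact: frame_lattice_basis.
by move: free_frame; rewrite /free => /eqP ->; rewrite !size_map.
Qed.

End Pencil.
End UnimodularBasis.

(** * Positions of the masts, mast segments and neighbours *)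

Section Dynamics.
Variables (R : realFieldType) (n : nat) (P : farey n).
Hypothesis wfP : well_formed P.
Implicit Types (i m : nat) (c d l : 'I_n.+1).

Local Notation V m l := (emb R (pos P m l)).

(** Linear functionals are column vectors, so that they can be added. *)
Definition ev (u : 'cV[R]_n.+1) (x : 'rV[R]_n.+1) : R := (x *m u) 0 0.

Lemma evD u x y : ev u (x + y) = ev u x + ev u y.
Proof. by rewrite /ev mulmxDl mxE. Qed.

Lemma evZ u a x : ev u (a *: x) = a * ev u x.
Proof. by rewrite /ev -scalemxAl mxE. Qed.

Lemma ev0 u : ev u 0 = 0.
Proof. by rewrite /ev mul0mx mxE. Qed.

Lemma evB u x y : ev u (x - y) = ev u x - ev u y.
Proof. by rewrite -scaleN1r evD evZ mulN1r. Qed.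

Lemma ev_sum u (I : Type) (s : seq I) (p : pred I) (F : I -> 'rV[R]_n.+1) :
  ev u (\sum_(i <- s | p i) F i) = \sum_(i <- s | p i) ev u (F i).
Proof. exact: (big_morph (ev u) (evD u) (ev0 u)). Qed.

Lemma step_active m c : step P m = Some c -> c \in active P m.
Proof. by case: wfP => /(_ m c) + _ => /[apply] -[]. Qed.

Lemma step_card m c : step P m = Some c -> (1 < #|active P m|)%N.
Proof. by case: wfP => /(_ m c) + _ => /[apply] -[]. Qed.

Lemma active_sub i m : (i <= m)%N -> active P m \subset active P i.
Proof.
elim: m => [|m IH]; first by rewrite leqn0 => /eqP ->.
rewrite leq_eqVlt => /orP[/eqP -> //|/IH sub].
exact: fintype.subset_trans (subsetDl _ _) sub.
Qed.

Lemma step_prefix i m : (i <= m)%N -> step P m != None -> step P i != None.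
Proof.
move=> im; rewrite /step; case: pselect => // -[t mt] _.
by case: pselect => // -[]; exists t; apply: leq_ltn_trans im mt.
Qed.

Definition pos_mx m : 'M[int]_n.+1 := \matrix_l pos P m l.

Lemma row_pos m l : row l (pos_mx m) = pos P m l.
Proof. exact: rowK. Qed.

Lemma pos_step m c : step P m = Some c ->
  pos P m.+1 c = pos P m c + \sum_(l in active P m | l != c) pos P m l.
Proof.
by move=> st; rewrite /= st eqxx (bigD1 c) //= (step_active st).
Qed.

Lemma pos_stepN m l : step P m != Some l -> pos P m.+1 l = pos P m l.
Proof. by rewrite /= => /negPf ->. Qed.

#[local] Arguments pos : simpl never.

(** A step at [c] multiplies the matrix of positions by [1 + e r], where [e] is
    the unit column of [c] and [r] the indicator row of the other active
    indices; [r e = 0], so the inverse is [1 - e r]. *)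
Lemma pos_mx_unit m : pos_mx m \in unitmx.
Proof.
elim: m => [|m IH].
  suff -> : pos_mx 0 = 1%:M by apply: unitmx1.
  by apply/matrixP => i j; rewrite !mxE eqxx eq_sym.
case st: (step P m) => [c|]; last first.
  suff -> : pos_mx m.+1 = pos_mx m by [].
  by apply/row_matrixP => l; rewrite !row_pos pos_stepN // st.
pose r : 'rV[int]_n.+1 := \row_l ((l \in active P m) && (l != c))%:R.
pose e : 'cV[int]_n.+1 := delta_mx c 0.
have re : r *m e = 0.
  by apply/rowP => j; rewrite -colE !mxE eqxx andbF.
have ere : (e *m r) *m (e *m r) = 0.
  by rewrite mulmxA -[_ *m e]mulmxA re mulmx0 mul0mx.
have -> : pos_mx m.+1 = (1%:M + e *m r) *m pos_mx m.
  apply/row_matrixP => l; rewrite mulmxDl mul1mx -mulmxA.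
  rewrite linearD /= row_mul row_pos.
  have rE : r *m pos_mx m = \sum_(l in active P m | l != c) pos P m l.
    rewrite mulmx_sum_row [RHS]big_mkcond; apply: eq_bigr => j _.
    by rewrite mxE row_pos; case: ifP => _; rewrite ?scale1r ?scale0r.
  have -> : row l e = (l == c)%:R%:M.
    by apply/rowP => j; rewrite !mxE !ord1 !eqxx andbT mulr1n.
  rewrite mul_scalar_mx rE.
  have [->|lc] := eqVneq l c; first by rewrite scale1r pos_step // row_pos.
  rewrite scale0r addr0 pos_stepN ?row_pos // st.
  by apply: contra lc => /eqP[->].
rewrite unitmx_mul IH andbT.
suff /mulmx1_unit[] : (1%:M + e *m r) *m (1%:M - e *m r) = 1%:M by [].
by rewrite mulmxDl mul1mx mulmxBr mulmx1 ere subr0 subrK.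
Qed.

(** A functional may be prescribed on the positions at any one moment, because
    they form a basis. *)
Lemma functional m (f : 'I_n.+1 -> R) :
  exists u, forall l, ev u (V m l) = f l.
Proof.
have [u uP] := functional_exists (pos_mx_unit m) f.
by exists u => l; rewrite -uP row_pos.
Qed.

Lemma V_step m c : step P m = Some c ->
  V m.+1 c = V m c + \sum_(l in active P m | l != c) V m l.
Proof. by move=> st; rewrite pos_step // embD emb_sum. Qed.

Lemma V_stepN m l : step P m != Some l -> V m.+1 l = V m l.
Proof. by move=> st; rewrite pos_stepN. Qed.

Lemma ev_step u m c : (forall l, 0 <= ev u (V m l)) -> step P m = Some c ->
  {in active P m, forall j, ev u (V m j) <= ev u (V m.+1 c)}.
Proof.
move=> u0 st j Aj.
have -> : V m.+1 c = \sum_(l in active P m) V m l.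
  by rewrite (bigD1 c) ?step_active //= V_step.
by rewrite ev_sum (bigD1 j) //= lerDl sumr_ge0.
Qed.

(** Masts move by adding vectors of the cone of the yard, so a functional that
    is nonnegative at one moment grows along every mast from then on.  All
    comparisons between distant simplices rest on this. *)
Lemma ev_mono u i m : (forall l, 0 <= ev u (V i l)) -> (i <= m)%N ->
  forall l, ev u (V i l) <= ev u (V m l).
Proof.
move=> u0; elim: m => [|m IH]; first by rewrite leqn0 => /eqP ->.
rewrite leq_eqVlt => /orP[/eqP -> //|/IH {}IH] l; apply: le_trans (IH l) _.
have [st|st] := eqVneq (step P m) (Some l); last by rewrite V_stepN.
by apply: ev_step (step_active st) => // j; apply: le_trans (u0 j) (IH j).
Qed.

Lemma ev_mono_ge0 u i m : (forall l, 0 <= ev u (V i l)) -> (i <= m)%N ->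
  forall l, 0 <= ev u (V m l).
Proof. by move=> u0 im l; apply: le_trans (u0 l) (ev_mono u0 im l). Qed.

(** A stretch of time with a single stepping index and no drop inside it.  The
    drop at the final yard [j] is not restricted. *)
Definition run i j c (A : {set 'I_n.+1}) :=
  forall m, (i <= m < j)%N -> step P m = Some c /\ active P m = A.

Lemma run_pos i j c A m : run i j c A -> (i <= m <= j)%N ->
  (forall l, l != c -> pos P m l = pos P i l) /\
  pos P m c = pos P i c + (m - i)%N%:Z *: \sum_(l in A | l != c) pos P i l.
Proof.
move=> rn; elim: m => [|m IH].
  by rewrite leqn0 => /andP[/eqP -> _]; rewrite subnn scale0r addr0.
case/andP; rewrite leq_eqVlt => /orP[/eqP <- _|].
  by rewrite subnn scale0r addr0.
rewrite ltnS => im mj; have [|st Am] := rn m; first by rewrite im.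
have [|other onc] := IH; first by rewrite im ltnW.
split=> [l lc|].
  rewrite pos_stepN ?other // st.
  by apply: contra lc => /eqP[->].
rewrite pos_step // Am onc subSn // intS scalerDl scale1r addrA addrAC.
by congr (_ + _); apply: eq_bigr => l /andP[_ lc]; rewrite other.
Qed.

Lemma run_V i j c A m : run i j c A -> (i <= m <= j)%N ->
  (forall l, l != c -> V m l = V i l) /\
  V m c = V i c + (m - i)%N%:R *: \sum_(l in A | l != c) V i l.
Proof.
move=> rn im; have [other onc] := run_pos rn im.
split=> [l lc|]; first by rewrite other.
by rewrite onc embD embZ emb_sum.
Qed.

Lemma coordinate_sum m (A : {set 'I_n.+1}) c j u : ev u (V m j) = 1 ->
    (forall l, l != j -> ev u (V m l) = 0) -> j != c ->
  ev u (\sum_(l in A | l != c) V m l) = (j \in A)%:R.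
Proof.
move=> uj ul jc; rewrite ev_sum; case: (boolP (j \in A)) => jA.
  rewrite (bigD1 j) ?jA //= uj big1 ?addr0 // => l /andP[_ lj]; exact: ul.
by rewrite big1 // => l /andP[lA _]; apply: ul; apply: contraTneq lA => ->.
Qed.

Lemma two_active m c : step P m = Some c -> exists2 j, j \in active P m & j != c.
Proof.
move=> st; have := step_card st; rewrite (cardsD1 c) (step_active st) ltnS.
by case/card_gt0P => j; rewrite !inE => /andP[jc jA]; exists j.
Qed.

(** The first and the last edge of a straight part are parallel.  The first has
    coordinate 0 along [c] in the basis at moment [f], and any step made at
    another index that is still active at the end would give the last edge a
    positive one.  So these other masts have not moved, and since the last edge
    is the sum of those still active, being parallel to the first leaves no
    room for a drop either. *)
Lemma collinear_run (M : segment n) : collinear_part R P M ->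
  run (seg_first M) (seg_last M).+1 (seg_mast M) (active P (seg_first M)).
Proof.
case: M => c f l [/= fl stf stl [p [d col]]].
have [t0 Vf] := col f ltac:(lia); have [t1 Vf1] := col f.+1 ltac:(lia).
have [t2 Vl] := col l ltac:(lia); have [t3 Vl1] := col l.+1 ltac:(lia).
set A := active P f.
pose E := \sum_(j in A | j != c) V f j.
pose E' := \sum_(j in active P l | j != c) V l j.
have ED : E = (t1 - t0) *: d.
  have -> : E = V f.+1 c - V f c by rewrite V_step // [V f c + _]addrC addrK.
  by rewrite Vf Vf1 scalerBl opprD addrACA subrr add0r.
have ED' : E' = (t3 - t2) *: d.
  have -> : E' = V l.+1 c - V l c by rewrite V_step // [V l c + _]addrC addrK.
  by rewrite Vl Vl1 scalerBl opprD addrACA subrr add0r.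
have t10 : t1 - t0 != 0.
  have [j jA jc] := two_active stf.
  have [u uP] := functional f (fun k => (k == j)%:R).
  apply: contraTneq isT => t10; have : ev u E = 1.
    rewrite (@coordinate_sum f _ _ j) ?jA // => [|k /negPf kj].
      by rewrite uP eqxx.
    by rewrite uP kj.
  by rewrite ED t10 scale0r ev0 => /eqP; rewrite eq_sym oner_eq0.
(* The coordinate along [c] at moment [f]: a step at another index [j] adds [V c]
   to [V j] and thus makes it positive. *)
have [y yP] := functional f (fun k => (k == c)%:R).
have y_ge0 k : 0 <= ev y (V f k) by rewrite yP ler0n.
have yd : ev y d = 0.
  have : ev y E = 0.
    by rewrite ev_sum big1 // => k /andP[_ /negPf kc]; rewrite yP kc.
  by rewrite ED evZ => /eqP; rewrite mulf_eq0 (negPf t10) => /eqP.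
have yl j : j \in active P l -> j != c -> ev y (V l j) = 0.
  move=> jA jc; have : ev y E' = 0 by rewrite ED' evZ yd mulr0.
  rewrite ev_sum => /eqP; rewrite psumr_eq0; last first.
    by move=> k _; apply: (ev_mono_ge0 y_ge0).
  by move=> /allP/(_ j (mem_index_enum j)); rewrite jA jc => /eqP.
have nostep j m : j \in active P l -> j != c -> (f <= m < l)%N ->
    step P m != Some j.
  move=> jA jc /andP[fm ml]; apply/eqP => st.
  have ym := ev_mono_ge0 y_ge0 fm.
  have ym1 := ev_mono_ge0 y_ge0 (leqW fm).
  suff : 1 <= ev y (V l j) by rewrite yl // ler10.
  apply: le_trans (ev_mono ym1 ml j).
  have cA : c \in active P m.
    exact: (fintype.subsetP (active_sub (ltnW ml))) (step_active stl).
  apply: le_trans (ev_step ym st cA).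
  by apply: le_trans (ev_mono y_ge0 fm c); rewrite yP eqxx.
have fixed j : j \in active P l -> j != c -> V l j = V f j.
  move=> jA jc.
  suff H m : (f <= m <= l)%N -> V m j = V f j by apply: H; rewrite fl leqnn.
  elim: m => [|m IH]; first by rewrite leqn0 => /andP[/eqP ->].
  case/andP; rewrite leq_eqVlt => /orP[/eqP <- //|fm ml].
  rewrite V_stepN; first by apply: IH; rewrite -ltnS fm ltnW.
  by apply: nostep; rewrite // -ltnS fm.
have E'E : (t1 - t0) *: \sum_(j in active P l | j != c) V f j = (t3 - t2) *: E.
  rewrite ED scalerA mulrC -scalerA -ED'; congr (_ *: _).
  by apply: eq_bigr => j /andP[jA jc]; rewrite fixed.
have sub : active P l \subset A by apply: active_sub.
have coordE j : j \in A -> j != c -> (t1 - t0) * (j \in active P l)%:R = t3 - t2.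
  move=> jA jc; have [u uP] := functional f (fun k => (k == j)%:R).
  have uj : ev u (V f j) = 1 by rewrite uP eqxx.
  have uk k : k != j -> ev u (V f k) = 0 by move=> /negPf kj; rewrite uP kj.
  have := congr1 (ev u) E'E; rewrite !evZ !(coordinate_sum _ uj uk) // jA.
  by rewrite mulr1.
have [j jl jc] := two_active stl.
have t32 : t3 - t2 = t1 - t0.
  by rewrite -(coordE j) ?(fintype.subsetP sub) // jl mulr1.
have Al : active P l = A.
  apply/eqP; rewrite finset.eqEsubset sub /=; apply/fintype.subsetP => k kA.
  have [->|kc] := eqVneq k c; first exact: step_active.
  have := coordE k kA kc; rewrite t32; case: (k \in _) => // /esym/eqP.
  by rewrite mulr0 (negPf t10).
move=> m /andP[fm]; rewrite ltnS => ml /=.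
have Am : active P m = A.
  by apply/eqP; rewrite finset.eqEsubset active_sub //= -Al active_sub.
split=> //; move: ml; rewrite leq_eqVlt => /orP[/eqP -> //|ml].
case st: (step P m) => [s|]; last first.
  by have := step_prefix (ltnW ml); rewrite st stl => /(_ isT).
have [-> //|sc] := eqVneq s c.
have sA : s \in active P l by rewrite Al -Am step_active.
by have := nostep s m sA sc; rewrite fm ml st eqxx => /(_ isT).
Qed.

Lemma run_collinear i j c A : (i < j)%N -> run i j c A ->
  collinear_part R P (Segment c i j.-1).
Proof.
move=> ij rn; split=> /=; first by lia.
- by have [] := rn i ltac:(lia).
- by have [] := rn j.-1 ltac:(lia).
exists (V i c), (\sum_(l in A | l != c) V i l) => m im; exists (m - i)%N%:R.
by have [_ <-] := run_V rn (m := m) ltac:(lia).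
Qed.

Lemma mast_segment_first (M N : segment n) :
    mast_segment R P M -> mast_segment R P N ->
    seg_first M = seg_first N -> seg_mast M = seg_mast N -> M = N.
Proof.
move=> [colM maxM] [colN maxN] eq_first eq_mast.
have [le|/ltnW le] := leqP (seg_last M) (seg_last N).
  by apply/esym/maxM => //; rewrite eq_first.
by apply: maxN => //; rewrite eq_first.
Qed.

Lemma mast_segment_last (M N : segment n) :
    mast_segment R P M -> mast_segment R P N ->
    seg_last M = seg_last N -> M = N.
Proof.
move=> [colM maxM] [colN maxN] eq_last.
have eq_mast : seg_mast M = seg_mast N.
  by have [_ _ + _] := colM; have [_ _ + _] := colN; rewrite eq_last => -> [].
have [le|/ltnW le] := leqP (seg_first M) (seg_first N).
  by apply: maxN => //; rewrite eq_last.
by apply/esym/maxM => //; rewrite eq_last.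
Qed.

Lemma nose_next_unique (M N1 N2 : segment n) :
  nose_stretching R P M N1 -> nose_stretching R P M N2 -> N1 = N2.
Proof.
move=> [_ mN1 _ f1 _] [_ mN2 _ f2 _]; have f12 : seg_first N1 = seg_first N2 by rewrite f1.
apply: mast_segment_first => //.
have [[_ + _ _] _] := mN1; have [[_ + _ _] _] := mN2.
by rewrite f12 => -> [].
Qed.

Lemma nose_prev_unique (M N1 N2 : segment n) :
  nose_stretching R P N1 M -> nose_stretching R P N2 M -> N1 = N2.
Proof.
move=> [mN1 _ _ f1 _] [mN2 _ _ f2 _]; apply: mast_segment_last => //.
by apply: succn_inj; rewrite -f1.
Qed.

(** Stretching [M] by one edge leads to the sum of the final positions of all
    the masts active along [M], and the first step of [N] to the sum over those
    active after [M].  Positions being independent, the two sums agree only if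
    no index was dropped. *)
Lemma nose_active (M N : segment n) : nose_stretching R P M N ->
  active P (seg_first N) = active P (seg_first M).
Proof.
move=> [[colM _] [colN _] _ fN]; have rn := collinear_run colM.
case: M N colM colN rn fN => c f l [d f' l'] /=.
rewrite /seg_start /seg_end /= => -[/= fl stf stl _] [/= f'l' std _ _] rn f'E.
rewrite f'E in std *; set A := active P f in rn *.
have [other _] := run_pos rn (m := l) ltac:(lia).
have [other1 _] := run_pos rn (m := l.+1) ltac:(lia).
have [_ Al] := rn l ltac:(lia).
have sumA : pos P l.+1 c + (pos P l.+1 c - pos P l c) = \sum_(j in A) pos P l.+1 j.
  rewrite [RHS](bigD1 c) /=; last by rewrite -Al step_active.
  congr (_ + _); rewrite pos_step // [pos P l c + _]addrC addrK Al.
  by apply: eq_bigr => j /andP[_ jc]; rewrite other // other1.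
have sumB : pos P l.+2 d = \sum_(j in active P l.+1) pos P l.+1 j.
  by rewrite (bigD1 d) ?step_active //= -pos_step.
rewrite sumA sumB => /(congr1 (@emb R _)); rewrite !emb_sum => sumE.
apply/setP => j; have [u uP] := functional l.+1 (fun k => (k == j)%:R).
have evA (X : {set 'I_n.+1}) : ev u (\sum_(k in X) V l.+1 k) = (j \in X)%:R.
  rewrite ev_sum (eq_bigr _ (fun k _ => uP k)) -natr_sum; congr _%:R.
  case: (boolP (j \in X)) => jX.
    by rewrite (bigD1 j) //= eqxx big1 // => k /andP[_ /negPf ->].
  by rewrite big1 // => k kX; case: eqP kX jX => // -> ->.
have := congr1 (ev u) sumE; rewrite !evA.
by case: (j \in _); case: (j \in _) => // /eqP; rewrite ?oner_eq0 // eq_sym oner_eq0.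
Qed.

(** An edge of a mast is primitive, since it is a sum of distinct vectors of a
    lattice basis; so the integer points of the segment are its vertices. *)
Lemma int_length_run f g c A : (f < g)%N -> run f g c A ->
  int_length R (pos P f c) (pos P g c) = (g - f)%N.
Proof.
move=> fg rn; have [_ ->] := run_pos rn (m := g) ltac:(lia).
set p := pos P f c; set E := \sum_(l in A | l != c) pos P f l.
have [st Af] := rn f ltac:(lia); have [j jA jc] := two_active st.
rewrite Af in jA; set L := (g - f)%N; have L0 : (0 < L)%N by lia.
have Lr : L%:R != 0 :> R by rewrite pnatr_eq0 -lt0n.
have Lr0 : 0 < L%:R :> R by rewrite ltr0n.
rewrite -[RHS](prednK L0) /int_length; congr _.+1; apply: card_fset_set.
have crdE : crd (pos_mx f) (emb R E) 0 j = 1.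
  have crd_ev x : crd (pos_mx f) x 0 j = ev (col j (map_mx intr (invmx (pos_mx f)))) x.
    by rewrite /crd /ev !mxE; apply: eq_bigr => k _; rewrite !mxE.
  have crdV l : crd (pos_mx f) (V f l) 0 j = (l == j)%:R.
    by rewrite -row_pos crd_basis // pos_mx_unit.
  rewrite crd_ev /E emb_sum (@coordinate_sum f _ _ j) ?jA // => [|l /negPf lj].
    by rewrite -crd_ev crdV eqxx.
  by rewrite -crd_ev crdV lj.
have E0 : E != 0.
  apply: contraTneq isT => E0; move: crdE; rewrite E0 emb0 crd0 => /eqP.
  by rewrite eq_sym oner_eq0.
have -> : [set z | exists t : R, 0 < t < 1 /\ emb R z = (1 - t) *: emb R p +
      t *: emb R (p + L%:Z *: E)]%classic =
    ((fun k : nat => p + k.+1%:Z *: E) @` `I_L.-1)%classic.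
  apply/seteqP; split=> [z [t [/andP[t0 t1] zE]]|_ [k kL <-]]; last first.
    exists (k.+1%:R / L%:R); split.
      rewrite divr_gt0 ?ltr0n //= ltr_pdivrMr // mul1r ltr_nat.
      by move: kL => /=; lia.
    rewrite !embD !embZ scalerBl scale1r scalerDr addrA subrK scalerA.
    by rewrite -[L%:~R]/(L%:R) divfK.
  have zp : emb R (z - p) = (t * L%:R) *: emb R E.
    rewrite embB zE embD embZ scalerBl scale1r scalerDr scalerA.
    by rewrite addrA subrK [emb R p + _]addrC addrK.
  pose a := ((z - p) *m invmx (pos_mx f)) 0 j.
  have aE : a%:~R = t * L%:R :> R.
    by rewrite -[LHS]crd_emb zp crdZ crdE mulr1.
  have a0 : 0 < a by rewrite -(ltr0z R) aE mulr_gt0.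
  have aL : a < L%:Z.
    by rewrite -(ltr_int R) aE -[L%:~R]/(L%:R) gtr_pMl.
  exists `|a|.-1%N; first by rewrite /=; lia.
  have -> : `|a|.-1.+1%:Z = a by lia.
  rewrite -[z in RHS](subrK p) addrC; congr (_ + _).
  by apply: (@emb_inj R); rewrite embZ aE zp.
apply: card_eq_trans (inj_card_eq _) _ => // k k' _ _ /addrI /eqP.
rewrite -subr_eq0 -scalerBl scalemx_eq0 (negPf E0) orbF subr_eq0 => /eqP.
by case.
Qed.
End Dynamics.

(** * Sails, division simplices and principal faces *)

Section Sails.
Variables (R : realFieldType) (n : nat) (P : farey n).
Hypothesis wfP : well_formed P.
Implicit Types (i j m : nat) (c d l : 'I_n.+1) (A : {set 'I_n.+1}).

Local Notation V m l := (emb R (pos P m l)).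
#[local] Arguments pos : simpl never.
#[local] Arguments active : simpl never.

Lemma ev_addl (u v : 'cV[R]_n.+1) x : ev (u + v) x = ev u x + ev v x.
Proof. by rewrite /ev mulmxDr mxE. Qed.

Lemma ev_scalel a (u : 'cV[R]_n.+1) x : ev (a *: u) x = a * ev u x.
Proof. by rewrite /ev -scalemxAr mxE. Qed.

Lemma ev_expand u m x :
  ev u x = \sum_l crd (pos_mx P m) x 0 l * ev u (V m l).
Proof.
rewrite {1}[x](crd_expand (pos_mx_unit wfP m)) ev_sum.
by apply: eq_bigr => l _; rewrite evZ row_pos.
Qed.

Lemma conv_ev_le (s : seq 'rV[R]_n.+1) u b x :
  {in s, forall v, ev u v <= b} -> conv s x -> ev u x <= b.
Proof.
move=> sb [w [w0 w1 ->]]; rewrite ev_sum -[b]mul1r -w1 mulr_suml.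
by apply: ler_sum => i _; rewrite evZ ler_wpM2l // sb // mem_nth.
Qed.

Lemma conv_ev_ge (s : seq 'rV[R]_n.+1) u b x :
  {in s, forall v, b <= ev u v} -> conv s x -> b <= ev u x.
Proof.
move=> sb [w [w0 w1 ->]]; rewrite ev_sum -[b]mul1r -w1 mulr_suml.
by apply: ler_sum => i _; rewrite evZ ler_wpM2l // sb // mem_nth.
Qed.

Lemma mem_conv (s : seq 'rV[R]_n.+1) x : x \in s -> conv s x.
Proof.
move=> sx; have [o <-] : exists o : 'I_(size s), s`_o = x.
  by move: (sx); rewrite -index_mem => lt; exists (Ordinal lt); rewrite nth_index.
exists (fun i => (i == o)%:R); split=> [i||].
- by rewrite ler0n.
- rewrite (bigD1 o) //= eqxx big1 ?addr0 // => i.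
  by rewrite -val_eqE /= => /negPf ->.
rewrite (bigD1 o) //= eqxx scale1r big1 ?addr0 // => i.
by rewrite -val_eqE /= => /negPf ->; rewrite scale0r.
Qed.

(** A change of the stepping index or a drop inside the interval would produce
    a principal yard there. *)
Lemma consecutive_run i j : consecutive_principal P i j ->
  (i < j)%N /\ exists c, run P i j c (active P i).
Proof.
move=> [ij _ /andP[yj _] np]; split=> //.
have prefix m : (m < j)%N -> step P m != None.
  case: j yj {np ij} => //= j yj mj; exact: (step_prefix (m := j)).
case st: (step P i) => [c|]; last by have := prefix i ij; rewrite st.
exists c; elim=> [|m IH]; first by rewrite leqn0 => /andP[/eqP i0 _]; rewrite -{1 2}i0.
case/andP; rewrite leq_eqVlt => /orP[/eqP <- //|].
rewrite ltnS => im mj; have [stm Am] := IH ltac:(lia).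
have yard_m1 : is_yard P m.+1 by rewrite /= stm.
have := np m.+1 ltac:(lia); rewrite /principal yard_m1 /=.
rewrite !negb_or -leqNgt negbK => /and3P[_ dimm /eqP ->]; split=> //.
apply/eqP; rewrite -Am eqEcard active_sub //=.
have : active P m.+1 != finset.set0 by case: wfP => _; apply.
by rewrite -card_gt0; move: dimm; rewrite /yard_dim /=; lia.
Qed.

(** Along a run the only displacement is a multiple of one edge, so a functional
    that vanishes on the edge is constant on each mast. *)
Lemma run_ev i j d A u : run P i j d A ->
    ev u (\sum_(l in A | l != d) V i l) = 0 ->
  forall m l, (i <= m <= j)%N -> ev u (V m l) = ev u (V i l).
Proof.
move=> rn uE m l im; have [other onc] := run_V R wfP rn im.
have [->|/other -> //] := eqVneq l d.
by rewrite onc evD evZ uE mulr0 addr0.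
Qed.

Lemma division_vertexP i j d A v : (i < j)%N -> run P i j d A ->
    v \in map (vertex_point R P) (yard P i ++ yard P j) ->
  exists l m, [/\ l \in A, (i <= m <= j)%N & v = V m l].
Proof.
move=> ij rn /mapP[[l m] + ->]; have [_ Ai] := rn i ltac:(lia).
rewrite mem_cat => /orP[]/mapP[k kA [-> ->]]; rewrite mem_enum in kA.
  by exists k, i; rewrite -Ai kA; split=> //; lia.
exists k, j; split=> //; last by lia.
by rewrite -Ai; apply: (fintype.subsetP (active_sub _ (ltnW ij))).
Qed.

Lemma division_le1 i j d A u x : (i < j)%N -> run P i j d A ->
    (forall l, ev u (V j l) = 1) -> division_simplex P i j x ->
  ev u x <= 1.
Proof.
move=> ij rn u1; apply: conv_ev_le => v /(division_vertexP ij rn)[l [m [lA im ->]]].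
have [other ond] := run_V R wfP rn im.
have [otherj ondj] := run_V R wfP rn (m := j) ltac:(lia).
have [->|ld] := eqVneq l d; last by rewrite other // -otherj // u1.
have E0 : 0 <= ev u (\sum_(k in A | k != d) V i k).
  rewrite ev_sum; apply: sumr_ge0 => k /andP[_ kd].
  by rewrite -otherj // u1.
rewrite -(u1 d) ond ondj !evD !evZ lerD2l ler_wpM2r // ler_nat; lia.
Qed.

Lemma division_ge1 i j d A u x k : (i < j)%N -> run P i j d A -> (k <= i)%N ->
    (forall l, ev u (V k l) = 1) -> division_simplex P i j x ->
  1 <= ev u x.
Proof.
move=> ij rn ki u1; apply: conv_ev_ge => v /(division_vertexP ij rn)[l [m [lA im ->]]].
rewrite -(u1 l); apply: ev_mono => // [l'|]; first by rewrite u1.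
by lia.
Qed.

(** Take the functional equal to 1 on all positions at one moment.  It is at
    most 1 on division simplices that end at this moment and at least 1 on those
    that begin then or later.  Applied at the end of the simplex and after the first step of [N],
    this shows that [N] neither ends after the simplex nor begins before it;
    then all the steps of the simplex are at the mast of [N], and maximality of
    [N] identifies the end yards. *)
Lemma division_of_mast_segment (N : segment n) i j d A : (i < j)%N ->
    run P i j d A -> mast_segment R P N ->
    (@seg_set R n P N `<=` division_simplex P i j)%classic ->
  [/\ i = seg_first N, j = (seg_last N).+1 & d = seg_mast N].
Proof.
move=> ij rn [colN maxN] ND; have rnN := collinear_run wfP colN.
have [/= fl stf stl _] := colN.
case: N colN maxN ND rnN fl stf stl => c f l.
rewrite /seg_set /seg_start /seg_end /= => colN maxN ND rnN fl stf stl.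
have Df : division_simplex P i j (V f c).
  by apply/ND/mem_conv; rewrite inE eqxx.
have Dl : division_simplex P i j (V l.+1 c).
  by apply/ND/mem_conv; rewrite !inE eqxx orbT.
have lj : (l < j)%N.
  rewrite ltnNge; apply/negP => jl.
  have [u u1] := functional wfP j (fun=> 1 : R).
  have := division_le1 ij rn u1 Dl; apply/negP; rewrite -ltNge V_step // evD.
  have ul k : 1 <= ev u (V l k).
    by rewrite -(u1 k); apply: ev_mono => // k'; rewrite u1.
  have [k kA kc] := two_active wfP stl.
  rewrite ev_sum (bigD1 k) ?kA //=.
  apply: (@lt_le_trans _ _ (1 + (1 + 0))); first by rewrite addr0 ltrDl ltr01.
  rewrite !lerD // ?ul // sumr_ge0 // => k' _; exact: le_trans ler01 (ul k').
have fi : (i <= f)%N.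
  rewrite leqNgt; apply/negP => fi.
  have [u u1] := functional wfP f.+1 (fun=> 1 : R).
  have := division_ge1 ij rn fi u1 Df; apply/negP; rewrite -ltNge.
  have -> : V f c = V f.+1 c - \sum_(k in active P f | k != c) V f k.
    by rewrite V_step // addrK.
  have uf k : k != c -> ev u (V f k) = 1.
    move=> kc; rewrite -(u1 k) V_stepN // stf.
    by apply: contra kc => /eqP[->].
  have [k kA kc] := two_active wfP stf.
  rewrite evB u1 ev_sum (bigD1 k) ?kA //= uf // opprD addrA subrr sub0r.
  apply: le_lt_trans ltr01; rewrite oppr_le0 sumr_ge0 // => k' /andP[/andP[_ k'c] _].
  by rewrite uf.
have [std _] := rn f ltac:(lia); move: std; rewrite stf => -[cd]; subst d.
have lj1 : (l <= j.-1)%N by lia.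
have [-> lE] := maxN _ (run_collinear R wfP ij rn) (erefl _) fi lj1.
by split=> //; lia.
Qed.

Lemma functional_ext m (u v : 'cV[R]_n.+1) x :
  (forall l, ev u (V m l) = ev v (V m l)) -> ev u x = ev v x.
Proof.
by move=> uv; rewrite !(ev_expand _ m); apply: eq_bigr => l _; rewrite uv.
Qed.

(** The functional whose level 1 contains the facet opposite to the mast [c].
    Its value on [c] is chosen so that it vanishes on every edge
    [sum_(l in A, l <> d) V_l] of another mast [d], hence does not change
    along the steps of the division simplex. *)
Definition tilt A c l : R := if l == c then 2 - #|A|%:R else 1.

Lemma tilt_sum A c d : c \in A -> d \in A -> c != d ->
  \sum_(l in A | l != d) tilt A c l = 0.
Proof.
move=> cA dA cd; rewrite (bigD1 c) ?cA //= /tilt eqxx.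
rewrite (eq_bigr (fun=> 1)); last by move=> l /andP[_ /negPf ->].
rewrite (eq_bigl (mem (A :\ c :\ d))) ?sumr_const; last first.
  by move=> l; rewrite !inE; case: (l == c); case: (l == d); case: (l \in A).
rewrite (cardsD1 c A) cA (cardsD1 d (A :\ c)) !inE eq_sym cd dA.
by rewrite !natrD /= -![true%:R]/1; ring.
Qed.

Lemma run_tilt i j c d A u : (i < j)%N -> run P i j d A -> c \in A -> c != d ->
    (forall l, ev u (V i l) = tilt A c l) ->
  forall m l, (i <= m <= j)%N -> ev u (V m l) = tilt A c l.
Proof.
move=> ij rn cA cd uP m l im; rewrite -uP; apply: (run_ev rn) => //.
have [std Ai] := rn i ltac:(lia).
rewrite ev_sum (eq_bigr (tilt A c)) ?tilt_sum // -Ai; exact: (step_active wfP std).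
Qed.

(** On the division simplex the tilt is at most 1, so only the lower bound
    matters.  It is clear when the Farey simplex carrying [x] belongs to the
    division simplex.

    If that simplex is later, let [g] be the sum of the coordinates at the yard
    [j] other than that of [c], and [s] the sum of them all.  Then [s <= 1] on
    the division simplex, and [g >= 1] on the later positions of the masts
    other than [c]; and the tilt is [(a - 1) g - (a - 2) s].

    If that simplex is earlier, let [y] be the coordinate of [c] at the yard
    just after it.  Then [y <= 0] on its vertices off the mast [c], while
    [tilt + (a - 1) y >= 1] on the division simplex. *)
Lemma sail_division i j c d A u x : (i < j)%N -> run P i j d A ->
    c \in A -> c != d -> (forall l, ev u (V i l) = tilt A c l) ->
    sail P c x -> division_simplex P i j x ->
  ev u x = 1.
Proof.
move=> ij rn cA cd uP [i' [c' [F [st' Fsub Fc Fx]]]] Dx.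
have uV := run_tilt ij rn cA cd uP.
have a2 : 2 <= #|A|%:R :> R.
  have [std <-] := rn i ltac:(lia).
  by rewrite (ler_nat R 2); apply: step_card wfP _ _ std.
have Fvert v : v \in map (vertex_point R P) F -> exists l m,
    [/\ l \in active P i', l != c, v = V m l & m = i' \/ m = i'.+1 /\ l = c'].
  move=> /mapP[[l m] lmF ->]; exists l, m.
  move: (Fc _ lmF) (Fsub _ lmF); rewrite inE /= => + /orP[/eqP[lE mE]|].
    by move=> lc; subst l m; split; [apply: (step_active wfP st')| | |right].
  by move=> lc /mapP[k kA [lk ->]]; rewrite mem_enum -lk in kA; split=> //; left.
apply/eqP; rewrite eq_le; apply/andP; split.
  apply: conv_ev_le Dx => v /(division_vertexP ij rn)[l [m [lA im ->]]].
  by rewrite uV // /tilt; case: ifP => _; lra.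
(* The Farey simplex is later than the division simplex. *)
have [ji'|i'j] := leqP j i'.
  have [s sP] := functional wfP j (fun=> 1 : R).
  have [g gP] := functional wfP j (fun l => (l != c)%:R : R).
  have s1 : ev s x <= 1 by apply: division_le1 ij rn sP Dx.
  have g1 : 1 <= ev g x.
    apply: conv_ev_ge Fx => v /Fvert[l [m [_ lc -> m_i']]].
    have -> : 1 = ev g (V j l) by rewrite gP lc.
    apply: ev_mono => // [k|]; first by rewrite gP ler0n.
    by case: m_i' => [->|[-> _]] //; apply: leqW.
  have -> : ev u x = ev ((#|A|%:R - 1) *: g + (2 - #|A|%:R) *: s) x.
    apply: (functional_ext (m := j)) => l.
    rewrite ev_addl !ev_scalel gP sP uV; last by lia.
    by rewrite /tilt; case: (l == c) => /=; ring.
  rewrite ev_addl !ev_scalel; nra.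
(* It is one of those that make up the division simplex. *)
have [ii'|i'i] := leqP i i'.
  apply: conv_ev_ge Fx => v /Fvert[l [m [_ lc -> m_i']]].
  rewrite uV; first by rewrite /tilt (negPf lc).
  by case: m_i' => [->|[-> _]]; lia.
(* It is earlier. *)
have [y yP] := functional wfP i'.+1 (fun l => (l == c)%:R : R).
have y_ge0 l : 0 <= ev y (V i'.+1 l) by rewrite yP ler0n.
have y0 : ev y x <= 0.
  apply: conv_ev_le Fx => v /Fvert[l [m [_ lc -> m_i']]].
  have yl : ev y (V i'.+1 l) = 0 by rewrite yP (negPf lc).
  case: m_i' => [->|[-> _]]; last by rewrite yl.
  have [lc'|lc'] := eqVneq l c'; last first.
    by rewrite -yl V_stepN // st'; apply: contra lc' => /eqP[->].
  subst c'.
  rewrite -yl V_step // evD lerDl ev_sum sumr_ge0 // => k /andP[_ kl].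
  rewrite -(@V_stepN R n P i') //.
  by rewrite st'; apply: contra kl => /eqP[->].
have : 1 <= ev (u + (#|A|%:R - 1) *: y) x.
  apply: conv_ev_ge Dx => v /(division_vertexP ij rn)[l [m [lA im ->]]].
  rewrite ev_addl ev_scalel uV //.
  have ym : ev y (V i'.+1 l) <= ev y (V m l) by apply: ev_mono => //; lia.
  move: ym; rewrite yP /tilt; case: (l == c) => /= ym; nra.
rewrite ev_addl ev_scalel; nra.
Qed.

Lemma crd_ev m (x : 'rV[R]_n.+1) l :
  crd (pos_mx P m) x 0 l = ev (col l (map_mx intr (invmx (pos_mx P m)))) x.
Proof. by rewrite /crd /ev !mxE; apply: eq_bigr => k _; rewrite !mxE. Qed.

Lemma crd_V m k l : @crd R _ (pos_mx P m) (V m k) 0 l = (k == l)%:R :> R.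
Proof. by rewrite -row_pos crd_basis // pos_mx_unit. Qed.

(** Within the span of the active masts, the kernel of the tilt is the plane of
    the pencil with parameter [a - 2], [a] being the number of active indices. *)
Lemma tilt_pencil m A c l0 (u : 'cV[R]_n.+1) x : l0 \in A -> l0 != c -> c \in A ->
    (forall l, ev u (V m l) = tilt A c l) ->
    (forall l, l \notin A -> crd (pos_mx P m) x 0 l = 0) -> ev u x = 0 ->
  x \in pencil R (pos_mx P m) l0 c (enum (A :\ l0)) (#|A|%:Z - 2).
Proof.
move=> l0A l0c cA uP xA ux.
apply/pencilP; rewrite ?pos_mx_unit ?enum_uniq ?mem_enum ?inE ?eqxx ?cA ?(eq_sym c) ?l0c //.
split=> [l|].
  by rewrite mem_enum !inE negb_and negbK => /orP[/eqP->|/xA //]; rewrite eqxx.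
have := ux; rewrite (ev_expand _ m) (bigD1 l0) //= (bigD1 c) 1?eq_sym //=.
rewrite !uP /tilt (negPf l0c) eqxx mulr1 => e.
have -> : \sum_(l <- enum (A :\ l0) | l != c) crd (pos_mx P m) x 0 l =
    \sum_(l | (l != l0) && (l != c)) crd (pos_mx P m) x 0 l * ev u (V m l).
  rewrite big_enum_cond [RHS](bigID (mem A)) /= [X in _ = _ + X]big1 ?addr0.
    apply: eq_big => [l|l]; first by rewrite !inE; case: (l \in A); case: eqP; case: eqP.
    by move=> /andP[_ /negPf lc]; rewrite uP /tilt lc mulr1.
  by move=> l /andP[_ lA]; rewrite xA // mul0r.
rewrite rmorphB /= -[#|A|%:~R]/(#|A|%:R).
by move: e; set S := \sum_(_ | _) _; lra.
Qed.

(** The face contains the initial positions of the masts other than [c] and the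
    end of [N], and their differences already generate the plane of the pencil;
    conversely [sail_division] bounds the face by the level 1 of the tilt.  The
    moment [t] is free in the range of [N], so that coordinates can be taken at
    the end of [N] where it precedes [M], and at its beginning where it
    follows. *)
Lemma principal_face_direction (N : segment n) c (F : set 'rV[R]_n.+1) pi l0 t
    (A := active P (seg_first N)) :
    mast_segment R P N -> principal_face P c F -> seg_mast N != c -> c \in A ->
    (seg_set P N `<=` F)%classic -> is_aff_span pi F -> l0 \in A -> l0 != c ->
    (seg_first N <= t <= (seg_last N).+1)%N ->
  direction pi = pencil R (pos_mx P t) l0 c (enum (A :\ l0)) (#|A|%:Z - 2) /\
  aff_set pi (V t l0).
Proof.
move=> segN [i [j [pF [pD [cons FE _ _ _]]]]] dc cA NF [Fpi pi_min] l0A l0c tN.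
have [ij [d rn]] := consecutive_run cons.
have [ei ej ed] := division_of_mast_segment ij rn segN
  (fun x Nx => proj2 (eq_ind _ (fun G => G x) (NF x Nx) _ FE)).
move: dc cA l0A tN; rewrite {}/A -ei -ej -ed => dc cA l0A tN.
set A := active P i in rn cA l0A *.
have [std _] := rn i ltac:(lia).
have dA : d \in A by apply: step_active std.
pose E := \sum_(l in A | l != d) V i l.
have FV l : l \in A -> l != c -> F (V i l).
  move=> lA lc; rewrite FE; split.
    exists i, d, [:: (l, i)]; split=> //.
    - move=> v; rewrite !inE => /eqP ->; rewrite map_f ?orbT // mem_enum //.
    - by move=> v; rewrite inE => /eqP ->.
    - by apply: mem_conv; rewrite inE.
  apply: mem_conv; apply/mapP; exists (l, i) => //.
  by rewrite mem_cat map_f // mem_enum.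
have Fd : F (V j d) by rewrite ej ed; apply/NF/mem_conv; rewrite !inE eqxx orbT.
have piV l : l \in A -> l != c -> aff_set pi (V i l) by move=> lA lc; apply/Fpi/FV.
have diffP x y : aff_set pi x -> aff_set pi y -> y - x \in direction pi.
  by move=> pix; rewrite (aff_setE _ pix).
have piD x y : aff_set pi x -> y \in direction pi -> aff_set pi (x + y).
  by move=> pix ydir; rewrite (aff_setE _ pix) addrC addKr.
have Edir : E \in direction pi.
  have := diffP _ _ (piV d dA dc) (Fpi _ Fd).
  have [_ ->] := run_V R wfP rn (m := j) ltac:(lia).
  rewrite addrC addKr rpredZeq pnatr_eq0 subn_eq0 leqNgt ij //.
have [othert ont] := run_V R wfP rn (m := t) ltac:(lia).
have piVt l : l \in A -> l != c -> aff_set pi (V t l).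
  move=> lA lc; have [->|ld] := eqVneq l d; last by rewrite othert //; apply: piV.
  by rewrite ont; apply: piD; [apply: piV|apply: memvZ].
have ldir l : l \in A -> l != c -> V t l - V t l0 \in direction pi.
  by move=> lA lc; apply: diffP; apply: piVt.
split; last exact: piVt.
have E_t : E = \sum_(l in A | l != d) V t l.
  by apply: eq_bigr => l /andP[_ ld]; rewrite othert.
apply/eqP; rewrite eqEsubv; apply/andP; split; last first.
  apply/span_subvP => _ /mapP[_ /mapP[l lA ->] ->].
  move: lA; rewrite mem_enum !inE => /andP[ll0 lA].
  rewrite embD embZ !row_pos /slope.
  have [->|lc] := eqVneq l c; last by rewrite mulrN1z scaleN1r ldir.
  (* The generator of index [c] is the edge of [N] minus differences of masts. *)
  pose B := A :\ d :\ c.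
  have cardA : #|A|%:Z - 2 = #|B|%:Z.
    rewrite (cardsD1 d A) dA (cardsD1 c (A :\ d)) !inE cA eq_sym dc /B.
    by rewrite /= !add1n; set X := #|_|; lia.
  have EB : E = V t c + \sum_(l in B) V t l.
    rewrite E_t (bigD1 c) /=; last by rewrite cA eq_sym.
    congr (_ + _); apply: eq_bigl => k.
    by rewrite !inE; case: (k == c); case: (k == d); case: (k \in A).
  have -> : V t c + (#|A|%:Z - 2)%:~R *: V t l0 =
      E - \sum_(l in B) (V t l - V t l0).
    rewrite cardA EB sumrB sumr_const opprB addrACA subrr addr0.
    by rewrite -[#|B|%:~R]/(#|B|%:R) scaler_nat.
  apply: memvB => //; apply: memv_suml => k; rewrite !inE => /and3P[kc _ kA].
  exact: ldir.
have [u uP] := functional wfP i (tilt A c).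
have ut := run_tilt ij rn cA ltac:(by rewrite eq_sym) uP.
pose q := Affine (V t l0) (pencil R (pos_mx P t) l0 c (enum (A :\ l0)) (#|A|%:Z - 2)).
have Fq : (F `<=` aff_set q)%classic.
  move=> x; rewrite {1}FE => -[sx Dx]; rewrite /aff_set /=.
  apply: (tilt_pencil (u := u)) => //.
  - by move=> l; apply: ut; lia.
  - move=> l lA; rewrite crdB crd_V.
    have -> : (l0 == l) = false by apply: contraNF lA => /eqP <-.
    rewrite subr0 crd_ev; set w := col _ _.
    have w0 v : v \in map (vertex_point R P) (yard P i ++ yard P j) -> ev w v = 0.
      move=> /(division_vertexP ij rn)[k [m [kA im ->]]].
      have wt k' : k' \in A -> ev w (V t k') = 0.
        move=> k'A; rewrite -crd_ev crd_V.
        by case: eqP lA k'A => // -> /negPf ->.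
      have wE : ev w E = 0.
        by rewrite E_t ev_sum big1 // => k' /andP[k'A _]; apply: wt.
      by rewrite (run_ev rn wE) // -(run_ev rn wE (m := t)) ?wt //; lia.
    apply/eqP; rewrite eq_le; apply/andP; split.
      by apply: conv_ev_le Dx => v /w0 ->.
    by apply: conv_ev_ge Dx => v /w0 ->.
  rewrite evB ut; last by lia.
  rewrite /tilt (negPf l0c) (sail_division ij rn cA _ uP sx Dx) ?subrr //.
  by rewrite eq_sym.
have sub := pi_min q Fq.
apply/subvP => v vdir.
have := sub _ (piD _ _ (piVt l0 l0A l0c) vdir).
by rewrite /aff_set /= addrC addKr.
Qed.

(** Moving the mast [c] by [g - f] edges adds to its vector [g - f] times the sum
    of the [a - 1] others, which shifts the parameter of the pencil by
    [(g - f) (a - 1)]. *)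
Lemma pencil_run f g c A l0 (p : int) : (f < g)%N -> run P f g c A ->
    c \in A -> l0 \in A -> l0 != c ->
  pencil R (pos_mx P g) l0 c (enum (A :\ l0)) p =
  pencil R (pos_mx P f) l0 c (enum (A :\ l0)) (p + (g - f)%:Z * (#|A|%:Z - 1)).
Proof.
move=> fg rn cA l0A l0c; set s := enum _.
have us : uniq s by apply: enum_uniq.
have l0s : l0 \notin s by rewrite mem_enum !inE eqxx.
have cs : c \in s by rewrite mem_enum !inE cA eq_sym l0c.
apply/eqP; rewrite eqEdim !dim_pencil ?pos_mx_unit // leqnn andbT.
have [other onc] := run_V R wfP rn (m := g) ltac:(lia).
set p' := p + _.
have gen l : l \in s -> V f l + (slope c p' l)%:~R *: V f l0 \in
    pencil R (pos_mx P f) l0 c s p'.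
  move=> ls; rewrite memv_span //; apply/mapP.
  exists (pos P f l + slope c p' l *: pos P f l0); last by rewrite embD embZ.
  by apply/mapP; exists l; rewrite ?row_pos.
apply/span_subvP => _ /mapP[_ /mapP[l ls ->] ->].
rewrite embD embZ !row_pos.
have [->|lc] := eqVneq l c; last first.
  by have := gen l ls; rewrite /slope (negPf lc) !other.
pose B := A :\ c.
have cardA : #|A|%:Z - 1 = #|B|%:Z by rewrite (cardsD1 c A) cA /= add1n /B; set X := #|_|; lia.
have -> : V g c + (slope c p c)%:~R *: V g l0 =
    (V f c + (slope c p' c)%:~R *: V f l0)
    + (g - f)%N%:R *: \sum_(l in B) (V f l - V f l0).
  rewrite /slope eqxx onc other // /p' cardA sumrB sumr_const.
  have -> : \sum_(k in A | k != c) V f k = \sum_(k in B) V f k.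
    by apply: eq_bigl => k; rewrite !inE andbC.
  set S := \sum_(_ in _) _.
  rewrite rmorphD rmorphM /= -[#|B|%:~R]/(#|B|%:R) -[((g - f)%N%:Z)%:~R]/((g - f)%N%:R).
  rewrite -scaler_nat scalerBr scalerA scalerDl.
  by rewrite -!addrA; congr (_ + _); rewrite [X in _ = _ + X]addrCA subrr addr0 addrC.
apply: memvD; first exact: gen.
apply/memvZ/memv_suml => k; rewrite !inE => /andP[kc kA].
have [->|kl0] := eqVneq k l0; first by rewrite subrr mem0v.
have := gen k; rewrite mem_enum !inE kl0 kA => /(_ isT).
by rewrite /slope (negPf kc) mulrN1z scaleN1r.
Qed.

End Sails.

(** * Duality of integer lengths and integer sines *)

Theorem proposition3p45 (R : realFieldType) (n : nat) (P : farey n)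
    (hP : well_formed P) (M N1 N2 : segment n)
    (hM : mast_segment R P M)
    (hN1 : neighbours R P M N1) (hN2 : neighbours R P M N2) (hN : N1 <> N2)
    (F1 F2 : set 'rV[R]_n.+1)
    (hF1 : principal_face P (seg_mast M) F1)
    (hF2 : principal_face P (seg_mast M) F2)
    (hNF1 : (seg_set P N1 `<=` F1)%classic)
    (hNF2 : (seg_set P N2 `<=` F2)%classic)
    (pi1 pi2 : affine R n.+1)
    (hpi1 : is_aff_span pi1 F1) (hpi2 : is_aff_span pi2 F2)
    (k : nat) (hk1 : aff_dim pi1 = k) (hk2 : aff_dim pi2 = k) :
  is_lsin pi1 pi2 (k * int_length R (seg_start P M) (seg_end P M))%N%:R.
Proof.
have rnM := collinear_run hP (proj1 hM).
have [fl stf _ _] := proj1 hM.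
have [l0 l0A l0c] := two_active hP stf; have cA := step_active hP stf.
have fg : (seg_first M < (seg_last M).+1)%N by [].
rewrite /seg_start /seg_end (int_length_run R hP fg rnM).
set f := seg_first M in stf l0A cA fl fg rnM *; set c := seg_mast M in stf l0c cA rnM hF1 hF2 *.
set g := (seg_last M).+1 in fg rnM *; set A := active P f in l0A cA rnM.
have [otherM _] := run_V R hP rnM (m := g) ltac:(lia).
pose s := enum (A :\ l0); pose B := pos_mx P f; pose a : int := #|A|%:Z - 1.
have a1 : a - 1 = #|A|%:Z - 2 by rewrite /a -addrA.
have previous N F pi : nose_stretching R P N M -> principal_face P c F ->
    (seg_set P N `<=` F)%classic -> is_aff_span pi F ->
    direction pi = pencil R B l0 c s (a - 1) /\ aff_set pi (emb R (row l0 B)).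
  move=> nose pF NF spF; have [segN _ dc fE _] := nose.
  have AE : active P (seg_first N) = A by rewrite -(nose_active hP nose).
  have [colN _] := segN; have [lN _ _ _] := colN.
  have cN : c \in active P (seg_first N) by rewrite AE.
  have l0N : l0 \in active P (seg_first N) by rewrite AE.
  have fN : (seg_first N <= f <= (seg_last N).+1)%N by lia.
  have [-> pif] := principal_face_direction hP segN pF dc cN NF spF l0N l0c fN.
  by rewrite AE row_pos a1.
have next N F pi : nose_stretching R P M N -> principal_face P c F ->
    (seg_set P N `<=` F)%classic -> is_aff_span pi F ->
    direction pi = pencil R B l0 c s (a - 1 + (g - f)%N%:Z * a) /\
    aff_set pi (emb R (row l0 B)).
  move=> nose pF NF spF; have [_ segN dc fE _] := nose.
  have AE : active P (seg_first N) = A by rewrite (nose_active hP nose).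
  have [colN _] := segN; have [lN _ _ _] := colN.
  have cN : c \in active P (seg_first N) by rewrite AE.
  have l0N : l0 \in active P (seg_first N) by rewrite AE.
  have gN : (seg_first N <= g <= (seg_last N).+1)%N by lia.
  rewrite eq_sym in dc.
  have [-> pig] := principal_face_direction hP segN pF dc cN NF spF l0N l0c gN.
  rewrite AE row_pos -otherM // -/s (pencil_run R hP _ fg rnM) //.
  by rewrite a1.
have s_uniq : uniq s by apply: enum_uniq.
have l0s : l0 \notin s by rewrite mem_enum !inE eqxx.
have cs : c \in s by rewrite mem_enum !inE cA eq_sym l0c.
have unitB : B \in unitmx by apply: pos_mx_unit.
have sizes : #|A| = (size s).+1 by rewrite -cardE (cardsD1 l0 A) l0A.
have aE : a = (size s)%:Z by rewrite /a sizes; lia.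
have s0 : (0 < size s)%N by case: (s) cs.
have kE : k = size s.
  rewrite -hk1 /aff_dim.
  case: hN1 => [/next|/previous] /(_ _ _ hF1 hNF1 hpi1) [-> _]; exact: dim_pencil.
have lE : `|((g - f)%N%:Z * a)%R|%N = (k * (g - f))%N by rewrite abszM kE aE mulnC.
have shift (b x : int) : b + x - b = x by rewrite addrC addKr.
have neq : a - 1 + (g - f)%N%:Z * a != a - 1.
  by rewrite -subr_eq0 shift -absz_eq0 lE kE muln_eq0; lia.
case: hN1 hN2 => [n1|n1] [n2|n2].
- by have := nose_next_unique n1 n2.
- have [d1 o1] := next _ _ _ n1 hF1 hNF1 hpi1.
  have [d2 o2] := previous _ _ _ n2 hF2 hNF2 hpi2.
  have := lsin_pencil unitB s_uniq l0s cs neq d1 d2 o1 o2.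
  by rewrite shift lE.
- have [d1 o1] := previous _ _ _ n1 hF1 hNF1 hpi1.
  have [d2 o2] := next _ _ _ n2 hF2 hNF2 hpi2.
  rewrite eq_sym in neq.
  have := lsin_pencil unitB s_uniq l0s cs neq d1 d2 o1 o2.
  by rewrite -abszN opprB shift lE.
- by have := nose_prev_unique n1 n2.
Qed.
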